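(* Let $g:\mathbb{R}^n\to\mathbb{R}^m$ be computable, open, and continuously differentiable with computable derivative $g'$. Then the image mapping $R\mapsto g[R]$ on bounded regular closed sets $R\subseteq\mathbb{R}^n$ is $(\bar\theta^n_<\to\bar\theta^m_<)$-computable.
   Context: A set $R\subseteq\mathbb{R}^d$ is regular (closed) if it equals the closure of its interior. $\theta^d_<$ represents open subsets of $\mathbb{R}^d$ by lists of rational centers and radii of open balls whose union is the set; $\bar\theta^d_<$ represents a regular closed set $R$ by a $\theta^d_<$-name of some open $U$ with $\overline{U}=R$ (equivalently, a list of open rational balls whose union is dense in $R$). Computability in the Type-2 sense (Weihrauch) with Cauchy representation for real vectors. *)

(* Defs.v *)
From HB Require Import structures.
From mathcomp Require Import all_boot all_order all_algebra.
From mathcomp Require Import all_classical all_reals all_analysis.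
From mathcomp Require Import Rstruct Rstruct_topology.
From Stdlib Require Rdefinitions.

Set Implicit Arguments.
Unset Strict Implicit.
Unset Printing Implicit Defensive.

Import Order.TTheory GRing.Theory Num.Theory.
Import numFieldNormedType.Exports.
Local Open Scope classical_set_scope.

Notation Rl := Rdefinitions.R.

Inductive rcode : Type :=
| RZero
| RSucc
| RProj of nat
| RComp of rcode & seq rcode
| RRec of rcode & rcode
| RMu of rcode.

Inductive reval : rcode -> seq nat -> nat -> Prop :=
| ev_zero args : reval RZero args 0%N
| ev_succ (x : nat) args : reval RSucc (x :: args) x.+1
| ev_proj i args : reval (RProj i) args (nth 0%N args i)
| ev_comp f gs args ys z :
    revals gs args ys -> reval f ys z -> reval (RComp f gs) args z
| ev_rec0 f g args z : reval f args z -> reval (RRec f g) (0%N :: args) z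
| ev_recS f g (k : nat) args y z :
    reval (RRec f g) (k :: args) y -> reval g (k :: y :: args) z ->
    reval (RRec f g) (k.+1 :: args) z
| ev_mu f args (k : nat) :
    reval f (k :: args) 0%N ->
    (forall j : nat, (j < k)%N -> exists v : nat, v <> 0%N /\ reval f (j :: args) v) ->
    reval (RMu f) args k
with revals : seq rcode -> seq nat -> seq nat -> Prop :=
| evs_nil args : revals [::] args [::]
| evs_cons g gs args y ys :
    reval g args y -> revals gs args ys -> revals (g :: gs) args (y :: ys).

Definition computable_nat (alpha : nat -> nat) : Prop :=
  exists c : rcode, forall n : nat, reval c [:: n] (alpha n).

Definition npair (a b : nat) : nat := (((a + b) * (a + b).+1) %/ 2 + b)%N.

Fixpoint enc_list (s : seq nat) : nat :=
  if s is x :: s' then (npair x (enc_list s')).+1 else 0%N.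

Definition enc_int (z : int) : nat :=
  match z with Posz k => k.*2 | Negz k => k.*2.+1 end.

Local Open Scope ring_scope.

Definition rat_code := (int * nat)%type.
Definition q0 : rat_code := (Posz 0, 0%N).
Definition enc_rat (q : rat_code) : nat := npair (enc_int q.1) q.2.
Definition rat_val (q : rat_code) : Rl := q.1%:~R / (q.2.+1)%:R.

Definition enc_qvec (qs : seq rat_code) : nat := enc_list (map enc_rat qs).
Definition qvec (d : nat) (qs : seq rat_code) : 'rV[Rl]_d :=
  \row_(i < d) rat_val (nth q0 qs i).

(* Type-2 computability via Kleene associates                          *)
Definition runs (alpha : nat -> nat) (p q : nat -> nat) : Prop :=
  forall n : nat, exists k : nat,
    (forall j : nat, (j < k)%N -> alpha (npair n (enc_list (mkseq p j))) = 0%N) /\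
    alpha (npair n (enc_list (mkseq p k))) = (q n).+1.

Definition vec_name (d : nat) (x : 'rV[Rl]_d) (p : nat -> nat) : Prop :=
  forall k : nat, exists qs : seq rat_code,
    size qs = d /\ p k = enc_qvec qs /\
    forall i : 'I_d, `|x ord0 i - rat_val (nth q0 qs i)| <= (2 ^+ k)^-1.

Definition mx_name (n m : nat) (M : 'M[Rl]_(n, m)) (p : nat -> nat) : Prop :=
  forall k : nat, exists qs : seq rat_code,
    size qs = (n * m)%N /\ p k = enc_qvec qs /\
    forall (i : 'I_n) (j : 'I_m),
      `|M i j - rat_val (nth q0 qs (i * m + j)%N)| <= (2 ^+ k)^-1.

Definition eball (d : nat) (c : 'rV[Rl]_d) (r : Rl) : set 'rV[Rl]_d :=
  [set x | \sum_(i < d) (x ord0 i - c ord0 i) ^+ 2 < r ^+ 2].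

Definition ball_code (qs : seq rat_code) (a b : nat) : nat :=
  (npair (enc_qvec qs) (npair a b)).+1.

(* theta^d_< : p lists rational open balls (code 0 = no ball) whose union is U *)
Definition open_name (d : nat) (U : set 'rV[Rl]_d) (p : nat -> nat) : Prop :=
  (forall k : nat, p k = 0%N \/
     exists (qs : seq rat_code) (a b : nat), size qs = d /\ p k = ball_code qs a b) /\
  U = [set x | exists (k : nat) (qs : seq rat_code) (a b : nat),
          size qs = d /\ p k = ball_code qs a b /\
          eball (qvec d qs) (a%:R / (b.+1)%:R) x].

Definition rc_name (d : nat) (A : set 'rV[Rl]_d) (p : nat -> nat) : Prop :=
  exists U : set 'rV[Rl]_d, open_name U p /\ closure U = A.

Definition regular_closed (d : nat) (A : set 'rV[Rl]_d) : Prop :=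
  closure (interior A) = A.

Definition bounded_vset (d : nat) (A : set 'rV[Rl]_d) : Prop :=
  exists M : Rl, forall x, A x -> `|x| <= M.

Definition computable_vecfun (n m : nat) (f : 'rV[Rl]_n -> 'rV[Rl]_m) : Prop :=
  exists alpha, computable_nat alpha /\
    forall x p, vec_name x p -> exists q, runs alpha p q /\ vec_name (f x) q.

Definition computable_vec2mx (n m : nat) (f : 'rV[Rl]_n -> 'M[Rl]_(n, m)) : Prop :=
  exists alpha, computable_nat alpha /\
    forall x p, vec_name x p -> exists q, runs alpha p q /\ mx_name (f x) q.

Definition computable_rc_map (n m : nat)
    (F : set 'rV[Rl]_n -> set 'rV[Rl]_m) : Prop :=
  exists alpha, computable_nat alpha /\
    forall (A : set 'rV[Rl]_n) p,
      bounded_vset A -> regular_closed A -> rc_name A p ->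
      exists q, runs alpha p q /\ rc_name (F A) q.

(* Main.v *)
Require Import Defs.
From HB Require Import structures.
From mathcomp Require Import all_boot all_order all_algebra.
From mathcomp Require Import all_classical all_reals all_analysis.
From mathcomp Require Import Rstruct Rstruct_topology.
From mathcomp Require Import zify ring lra.

(* Let [U] be the named open set, so that [closure U = A]; by compactness of [A] it
   suffices to list balls contained in [g U] and dense in it.  At a rational point [c]
   where [g' c] has full rank, a rational approximate right inverse [B] of [g' c] makes
   [w |-> g (c + w B) - w] a contraction on a small box around [0], so the image of the
   box contains an explicit ball around [g c]; the finitely many rational inequalities
   that guarantee this are checked by the machine, which searches through all
   candidates.  The candidates reach a dense set because the full-rank points of [g']
   are dense: otherwise the rank would attain a maximum [r < m] over some open set, and
   near a point of maximal rank the fibres of [g] would be those of an [r]-dimensional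
   projection of [g], so that the image of a small ball could not be open. *)

Import Order.TTheory GRing.Theory Num.Theory.
Import numFieldNormedType.Exports.
Local Open Scope classical_set_scope.
Local Open Scope ring_scope.

Set Implicit Arguments.
Unset Strict Implicit.
Unset Printing Implicit Defensive.

(** * Computable functions on the natural numbers *)

(** Sard's theorem is not at hand for a merely continuously differentiable map when [n > m]; the
    rank argument takes its place. Where the rank of [g'] stays equal to that of [g' *m P], both
    derivatives have the same kernel, so [g'] vanishes in every direction tangent to a fibre of the
    projected map. Such a fibre is obtained by solving equations, which gives a curve that is
    Lipschitz but not known to be differentiable; hence the mean value inequality is proved for
    curves that satisfy only a local bound on increments. One quasi-Newton lemma does both jobs: it
    corrects a segment back onto a fibre, and it produces the certified image balls. Each output
    entry depends on a single input entry, whose index is part of the candidate, so a very simple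
    associate suffices. Sums [+ 1] in denominators such as [l1 B + 1] only keep them positive. *)

Definition computable_on (k : nat) (f : seq nat -> nat) : Prop :=
  exists c, forall a, size a = k -> reval c a (f a).

Lemma eq_computable_on k (f h : seq nat -> nat) :
  (forall a, size a = k -> f a = h a) -> computable_on k f -> computable_on k h.
Proof. by move=> fh [c cP]; exists c => a ak; rewrite -fh //; exact: cP. Qed.

Lemma computable_on_nth k i : computable_on k (fun a => nth 0%N a i).
Proof. by exists (RProj i) => a _; exact: ev_proj. Qed.

Lemma computable_on_succ k f :
  computable_on k f -> computable_on k (fun a => (f a).+1).
Proof.
move=> [c cP]; exists (RComp RSucc [:: c]) => a ak.
apply: (@ev_comp _ _ _ [:: f a]); last exact: ev_succ.
by apply: evs_cons; [exact: cP | exact: evs_nil].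
Qed.

Lemma computable_on_const k n : computable_on k (fun=> n).
Proof.
elim: n => [|n IH]; last exact: computable_on_succ.
by exists RZero => a _; exact: ev_zero.
Qed.

Lemma computable_on_comp1 k h f : computable_on 1 h -> computable_on k f ->
  computable_on k (fun a => h [:: f a]).
Proof.
move=> [ch hP] [cf fP]; exists (RComp ch [:: cf]) => a ak.
apply: (@ev_comp _ _ _ [:: f a]); last exact: hP.
by apply: evs_cons; [exact: fP | exact: evs_nil].
Qed.

Lemma computable_on_comp2 k h f1 f2 :
  computable_on 2 h -> computable_on k f1 -> computable_on k f2 ->
  computable_on k (fun a => h [:: f1 a; f2 a]).
Proof.
move=> [ch hP] [c1 f1P] [c2 f2P]; exists (RComp ch [:: c1; c2]) => a ak.
apply: (@ev_comp _ _ _ [:: f1 a; f2 a]); last exact: hP.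
apply: evs_cons; first exact: f1P.
by apply: evs_cons; [exact: f2P | exact: evs_nil].
Qed.

Lemma revals_proj (s a : seq nat) :
  revals (map RProj s) a (map (nth 0%N a) s).
Proof.
by elim: s => [|i s IH]; [exact: evs_nil | apply: evs_cons => //; exact: ev_proj].
Qed.

(** [RRec] recurses on the head of its argument list, so the bound [h a] is computed and put in
    front, and projections copy the parameters behind it. *)
Lemma computable_on_rec k f g h :
  computable_on k f -> computable_on k.+2 g -> computable_on k h ->
  computable_on k
    (fun a => nat_rect (fun=> nat) (f a) (fun i y => g (i :: y :: a)) (h a)).
Proof.
move=> [cf fP] [cg gP] [ch hP].
exists (RComp (RRec cf cg) (ch :: map RProj (iota 0 k))) => a ak.
apply: (@ev_comp _ _ _ (h a :: a)).
  apply: evs_cons; first exact: hP.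
  have := revals_proj (iota 0 k) a.
  by rewrite -[X in revals _ _ X -> _]/(mkseq (nth 0%N a) k) -ak mkseq_nth.
elim: (h a) => [|i IH]; first by apply: ev_rec0; exact: fP.
by apply: ev_recS IH _; apply: gP; rewrite /= ak.
Qed.

Definition computable_nat2 (h : nat -> nat -> nat) :=
  computable_on 2 (fun a => h (nth 0%N a 0) (nth 0%N a 1)).

Lemma computable_natE f :
  computable_nat f <-> computable_on 1 (fun a => f (nth 0%N a 0)).
Proof.
split=> [[c cP]|[c cP]]; exists c; first by move=> [|x []].
by move=> x; exact: (cP [:: x]).
Qed.

Lemma computable_on_op1 k f f1 : computable_nat f -> computable_on k f1 ->
  computable_on k (fun a => f (f1 a)).
Proof. by move=> /computable_natE h0 h1; exact: computable_on_comp1 h0 h1. Qed.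

Lemma computable_on_op2 k h f1 f2 :
  computable_nat2 h -> computable_on k f1 -> computable_on k f2 ->
  computable_on k (fun a => h (f1 a) (f2 a)).
Proof. by move=> h0 h1 h2; exact: computable_on_comp2 h0 h1 h2. Qed.

Lemma computable_nat2_add : computable_nat2 addn.
Proof.
apply: eq_computable_on (computable_on_rec (computable_on_nth 2 1)
  (computable_on_succ (computable_on_nth 4 1)) (computable_on_nth 2 0)) => a _ /=.
by elim: (nth _ _ 0) => //= i ->.
Qed.

Lemma computable_nat2_mul : computable_nat2 muln.
Proof.
apply: eq_computable_on (computable_on_rec (computable_on_const 2 0)
  (computable_on_op2 computable_nat2_add (computable_on_nth 4 1)
     (computable_on_nth 4 3)) (computable_on_nth 2 0)) => a _ /=.
by elim: (nth _ _ 0) => //= i ->; rewrite mulSn addnC.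
Qed.

Lemma computable_nat_pred : computable_nat predn.
Proof.
apply/computable_natE.
apply: eq_computable_on (computable_on_rec (computable_on_const 1 0)
  (computable_on_nth 3 0) (computable_on_nth 1 0)) => a _ /=.
by case: (nth _ _ 0).
Qed.

Lemma computable_nat2_sub : computable_nat2 subn.
Proof.
apply: eq_computable_on (computable_on_rec (computable_on_nth 2 0)
  (computable_on_op1 computable_nat_pred (computable_on_nth 4 1))
  (computable_on_nth 2 1)) => a _ /=.
by elim: (nth _ _ 1) => [|i /= ->]; rewrite ?subn0 // subnS.
Qed.

(** * The Cantor pairing and its inverses *)

Definition tri (w : nat) : nat :=
  nat_rect (fun=> nat) 0%N (fun i y => (y + i.+1)%N) w.

(** The recursive form makes [npair] computable without a quotient. *)
Lemma triE w : ((w * w.+1) %/ 2 = tri w)%N.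
Proof.
elim: w => //= w <-; have -> : (w.+1 * w.+2 = w.+1 * 2 + w * w.+1)%N by lia.
by rewrite divnMDl // addnC.
Qed.

Lemma computable_nat_tri : computable_nat tri.
Proof.
apply/computable_natE; exact: (computable_on_rec (computable_on_const 1 0)
  (computable_on_op2 computable_nat2_add (computable_on_nth 3 1)
     (computable_on_succ (computable_on_nth 3 0))) (computable_on_nth 1 0)).
Qed.

(* [diag z] is the greatest [w] with [tri w <= z]: the index of the antidiagonal
   of [z] in the Cantor enumeration; as [tri (diag i).+1 >= i.+1], the
   subtraction below tests for equality. *)
Definition diag (z : nat) : nat :=
  nat_rect (fun=> nat) 0%N
    (fun i y => (y + (1 - (tri y.+1 - i.+1)))%N) z.

Lemma diag_bounds z : (tri (diag z) <= z < tri (diag z).+1)%N.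
Proof.
elim: z => // z /=; set d := diag z => /andP[h1 h2].
have [e|e] := leqP (tri d.+1) z.+1.
  have -> : (d + (1 - (tri d.+1 - z.+1)) = d.+1)%N by rewrite /= in e *; lia.
  by rewrite /= in e h2 *; lia.
have -> : (d + (1 - (tri d.+1 - z.+1)) = d)%N by rewrite /= in e *; lia.
by rewrite /= in e h2 *; lia.
Qed.

Lemma leq_tri a b : (a <= b)%N -> (tri a <= tri b)%N.
Proof.
by move=> /subnK <-; elim: (b - a)%N => //= k IH; exact: leq_trans IH (leq_addr _ _).
Qed.

Definition usnd (z : nat) : nat := (z - tri (diag z))%N.
Definition ufst (z : nat) : nat := (diag z - usnd z)%N.

Lemma diag_npair a b : diag (npair a b) = (a + b)%N.
Proof.
have := diag_bounds (npair a b); rewrite /npair triE.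
move: (diag _) => d /andP[h1 h2]; apply/eqP; rewrite eqn_leq; apply/andP; split.
  rewrite leqNgt; apply/negP => /leq_tri /= h3; lia.
rewrite leqNgt; apply/negP => /leq_tri h3; rewrite /= in h2 h3; lia.
Qed.

Lemma usnd_npair a b : usnd (npair a b) = b.
Proof. by rewrite /usnd diag_npair /npair triE addKn. Qed.

Lemma ufst_npair a b : ufst (npair a b) = a.
Proof. by rewrite /ufst usnd_npair diag_npair addnK. Qed.

Lemma npair_unpair z : npair (ufst z) (usnd z) = z.
Proof.
have /andP[h1] := diag_bounds z; rewrite /= => h2.
have h : (usnd z <= diag z)%N by rewrite /usnd; lia.
by rewrite /npair triE /ufst subnK // /usnd subnKC.
Qed.

Lemma computable_nat_diag : computable_nat diag.
Proof.
apply/computable_natE.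
have sub := computable_on_op2 computable_nat2_sub.
have tS := computable_on_op1 computable_nat_tri
  (computable_on_succ (computable_on_nth 3 1)).
have := computable_on_op2 computable_nat2_add (computable_on_nth 3 1)
  (sub _ _ _ (computable_on_const 3 1)
    (sub _ _ _ tS (computable_on_succ (computable_on_nth 3 0)))).
by move=> /(computable_on_rec (computable_on_const 1 0));
  move=> /(_ _ (computable_on_nth 1 0)).
Qed.

Lemma eq_computable_nat f h : f =1 h -> computable_nat f -> computable_nat h.
Proof. by move=> fh [c cP]; exists c => x; rewrite -fh. Qed.

Lemma computable_nat_id : computable_nat id.
Proof. by apply/computable_natE; exact: computable_on_nth. Qed.

Lemma computable_nat_const k : computable_nat (fun=> k).
Proof. by apply/computable_natE; exact: computable_on_const. Qed.

Lemma computable_nat_comp f h :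
  computable_nat f -> computable_nat h -> computable_nat (fun e => f (h e)).
Proof.
by move=> hf /computable_natE hh; apply/computable_natE; exact: computable_on_op1.
Qed.

Lemma computable_nat_op2 op f h : computable_nat2 op ->
  computable_nat f -> computable_nat h -> computable_nat (fun e => op (f e) (h e)).
Proof.
move=> hop /computable_natE hf /computable_natE hh; apply/computable_natE.
exact: computable_on_op2 hop hf hh.
Qed.

Lemma computable_nat_add f h : computable_nat f -> computable_nat h ->
  computable_nat (fun e => f e + h e)%N.
Proof. exact: computable_nat_op2 computable_nat2_add. Qed.

Lemma computable_nat_mul f h : computable_nat f -> computable_nat h ->
  computable_nat (fun e => f e * h e)%N.
Proof. exact: computable_nat_op2 computable_nat2_mul. Qed.

Lemma computable_nat_sub f h : computable_nat f -> computable_nat h ->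
  computable_nat (fun e => f e - h e)%N.
Proof. exact: computable_nat_op2 computable_nat2_sub. Qed.

Lemma computable_nat_succ f :
  computable_nat f -> computable_nat (fun e => (f e).+1).
Proof.
by move=> hf; apply: eq_computable_nat
  (computable_nat_add hf (computable_nat_const 1)) => e; rewrite addn1.
Qed.

Lemma computable_nat_usnd f :
  computable_nat f -> computable_nat (fun e => usnd (f e)).
Proof.
move=> hf; apply: computable_nat_sub => //.
apply: computable_nat_comp computable_nat_tri _.
exact: computable_nat_comp computable_nat_diag hf.
Qed.

Lemma computable_nat_ufst f :
  computable_nat f -> computable_nat (fun e => ufst (f e)).
Proof.
move=> hf; apply: computable_nat_sub; last exact: computable_nat_usnd.
exact: computable_nat_comp computable_nat_diag hf.
Qed.

Lemma computable_nat2_npair : computable_nat2 npair.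
Proof.
have add := computable_on_op2 computable_nat2_add.
apply: (@eq_computable_on _
  (fun a => tri (nth 0%N a 0 + nth 0%N a 1) + nth 0%N a 1)%N).
  by move=> a _; rewrite /npair triE.
have sum := add _ _ _ (computable_on_nth 2 0) (computable_on_nth 2 1).
exact: (add _ _ _ (computable_on_op1 computable_nat_tri sum) (computable_on_nth 2 1)).
Qed.

Lemma computable_nat_npair f h : computable_nat f -> computable_nat h ->
  computable_nat (fun e => npair (f e) (h e)).
Proof. exact: computable_nat_op2 computable_nat2_npair. Qed.

(** The ternary step is presented as a unary function of a nested pair, so that the closure lemmas
    for unary functions apply to it. *)
Lemma computable_nat_rec f (g : nat -> nat -> nat -> nat) h :
  computable_nat f ->
  computable_nat (fun z => g (ufst z) (ufst (usnd z)) (usnd (usnd z))) ->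
  computable_nat h ->
  computable_nat
    (fun e => nat_rect (fun=> nat) (f e) (fun i y => g i y e) (h e)).
Proof.
move=> /computable_natE hf hg /computable_natE hh; apply/computable_natE.
have h2 := computable_on_op2 computable_nat2_npair
  (computable_on_nth 3 1) (computable_on_nth 3 2).
have h3 := computable_on_op2 computable_nat2_npair (computable_on_nth 3 0) h2.
have := computable_on_rec hf (computable_on_op1 hg h3) hh.
apply: eq_computable_on => a _.
by elim: (h _) => //= i ->; rewrite !(usnd_npair, ufst_npair).
Qed.

(** * Decidable predicates and unbounded search *)

Definition computable_pred (P : nat -> bool) := computable_nat (fun e => P e : nat).

Lemma computable_pred_eq0 f :
  computable_nat f -> computable_pred (fun e => f e == 0%N).
Proof.
move=> hf; apply: eq_computable_nat
  (computable_nat_sub (computable_nat_const 1) hf) => e.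
by case: (f e) => // k; rewrite subSS sub0n.
Qed.

Lemma computable_predN P :
  computable_pred P -> computable_pred (fun e => ~~ P e).
Proof.
move=> hP; apply: eq_computable_nat (computable_pred_eq0 hP) => e.
by case: (P e).
Qed.

Lemma computable_predI P Q : computable_pred P -> computable_pred Q ->
  computable_pred (fun e => P e && Q e).
Proof.
move=> hP hQ; apply: eq_computable_nat (computable_nat_mul hP hQ) => e.
by case: (P e); case: (Q e).
Qed.

Lemma computable_pred_leq f h : computable_nat f -> computable_nat h ->
  computable_pred (fun e => f e <= h e)%N.
Proof. by move=> hf hh; apply: computable_pred_eq0; exact: computable_nat_sub. Qed.

Lemma computable_nat_if P f h :
  computable_pred P -> computable_nat f -> computable_nat h ->
  computable_nat (fun e => if P e then f e else h e).
Proof.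
move=> hP hf hh; apply: eq_computable_nat (computable_nat_add
  (computable_nat_mul hP hf) (computable_nat_mul (computable_predN hP) hh)) => e.
by case: (P e); rewrite /= !(mul1n, mul0n, addn0).
Qed.

Lemma computable_nat_min P l : computable_nat (fun z => P (ufst z) (usnd z)) ->
  (forall e, P (l e) e = 0%N /\ forall j, (j < l e)%N -> P j e <> 0%N) ->
  computable_nat l.
Proof.
move=> hP lP.
have [c cP] : computable_on 2 (fun a => P (nth 0%N a 0) (nth 0%N a 1)).
  apply: eq_computable_on (computable_on_op1 hP (computable_on_op2
    computable_nat2_npair (computable_on_nth 2 0) (computable_on_nth 2 1))) => a _.
  by rewrite usnd_npair ufst_npair.
exists (RMu c) => e; have [l0 lN] := lP e; apply: ev_mu.
  by have := cP [:: l e; e] erefl; rewrite /= l0.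
by move=> j /lN Pj; exists (P j e); split => //; exact: (cP [:: j; e] erefl).
Qed.

(** Parity toggles with [1 - y], and half of a number counts the odd numbers below it. *)
Lemma computable_nat_half f :
  computable_nat f -> computable_nat (fun e => odd (f e) : nat) /\
  computable_nat (fun e => (f e)./2).
Proof.
move=> hf.
have oddP h : computable_nat h -> computable_nat (fun e => odd (h e) : nat).
  move=> hh; have := @computable_nat_rec (fun=> 0%N)
    (fun _ y _ => 1 - y)%N h (computable_nat_const _) _ hh.
  move=> H; apply: eq_computable_nat (H _).
    by move=> e; elim: (h e) => //= i ->; case: (odd _).
  apply: computable_nat_sub; first exact: computable_nat_const.
  apply: computable_nat_ufst; apply: computable_nat_usnd; exact: computable_nat_id.
split; first exact: oddP.
have := @computable_nat_rec (fun=> 0%N) (fun i y _ => y + odd i)%N f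
  (computable_nat_const _) _ hf.
move=> H; apply: eq_computable_nat (H _).
  by move=> e; elim: (f e) => [|i /= ->] //; rewrite uphalf_half addnC.
apply: computable_nat_add.
  apply: computable_nat_ufst; apply: computable_nat_usnd; exact: computable_nat_id.
apply: oddP; apply: computable_nat_ufst; exact: computable_nat_id.
Qed.

Lemma computable_nat_exp2 f :
  computable_nat f -> computable_nat (fun e => 2 ^ f e)%N.
Proof.
move=> hf; have := @computable_nat_rec (fun=> 1%N) (fun _ y _ => y + y)%N f
  (computable_nat_const _) _ hf.
move=> H; apply: eq_computable_nat (H _).
  by move=> e; elim: (f e) => //= i ->; rewrite expnS mul2n addnn.
by apply: computable_nat_add;
  apply: computable_nat_ufst; apply: computable_nat_usnd; exact: computable_nat_id.
Qed.

Lemma computable_nat_iter g f h :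
  computable_nat g -> computable_nat f -> computable_nat h ->
  computable_nat (fun e => iter (h e) g (f e)).
Proof.
move=> hg hf hh; have := @computable_nat_rec f (fun _ y _ => g y) h hf _ hh.
move=> H; apply: eq_computable_nat (H _); first by move=> e; elim: (h e) => //= i ->.
apply: computable_nat_comp hg _.
by apply: computable_nat_ufst; apply: computable_nat_usnd; exact: computable_nat_id.
Qed.

(** * Decoding lists, and associates that read one entry *)

Definition code_nth (i t : nat) : nat :=
  ufst (iter i (fun c => usnd c.-1) t).-1.

(** No bound on [i] is required: the code 0 of the empty list is a fixed point, since [usnd 0] is
    0. *)
Lemma iter_code_tail i s :
  iter i (fun c => usnd c.-1) (enc_list s) = enc_list (drop i s).
Proof.
elim: s i => [|x s IH] [|i] //; last by rewrite iterSr /= usnd_npair IH.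
by elim: i => //= i ->.
Qed.

Lemma code_nth_enc i s : (i < size s)%N -> code_nth i (enc_list s) = nth 0%N s i.
Proof.
move=> h; rewrite /code_nth iter_code_tail (drop_nth 0%N h) /=.
by rewrite ufst_npair.
Qed.

Lemma computable_nat_behead h f : computable_nat h -> computable_nat f ->
  computable_nat (fun e => iter (h e) (fun c => usnd c.-1) (f e)).
Proof.
move=> hh hf; apply: computable_nat_iter => //; apply: computable_nat_usnd.
exact: computable_nat_pred.
Qed.

Lemma computable_nat_code_nth h f : computable_nat h -> computable_nat f ->
  computable_nat (fun e => code_nth (h e) (f e)).
Proof.
move=> hh hf; apply: computable_nat_ufst.
apply: computable_nat_comp computable_nat_pred _; exact: computable_nat_behead.
Qed.

Lemma computable_nat_enc_list (I : Type) (F : I -> nat -> nat) s :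
  (forall i, computable_nat (F i)) ->
  computable_nat (fun e => enc_list [seq F i e | i <- s]).
Proof.
move=> hF; elim: s => [|i s IH]; first exact: computable_nat_const.
by apply: computable_nat_succ; exact: computable_nat_npair.
Qed.

Lemma computable_nat_enc_nseq f h : computable_nat f -> computable_nat h ->
  computable_nat (fun e => enc_list (nseq (h e) (f e))).
Proof.
move=> hf hh.
have := @computable_nat_rec (fun=> 0%N) (fun _ y e => (npair (f e) y).+1) h
  (computable_nat_const _) _ hh.
move=> H; apply: eq_computable_nat (H _).
  by move=> e; elim: (h e) => //= i ->.
have hz := computable_nat_usnd computable_nat_id.
apply: computable_nat_succ; apply: computable_nat_npair.
  by apply: computable_nat_comp hf _; exact: computable_nat_usnd.
exact: computable_nat_ufst.
Qed.

(** On query [t] the associate drops [idx t] entries from the prefix it is shown. It answers 0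
    (wait) while nothing remains; otherwise the head of the remainder is [p (idx t)]. *)
Lemma runs_pointwise (idx W : nat -> nat) : computable_nat idx -> computable_nat W ->
  exists2 alpha, computable_nat alpha &
    forall p, runs alpha p (fun t => W (npair t (p (idx t)))).
Proof.
move=> hi hW; pose d z := iter (idx (ufst z)) (fun c => usnd c.-1) (usnd z).
have hfst := computable_nat_ufst computable_nat_id.
have hd : computable_nat d.
  apply: computable_nat_behead; first exact: computable_nat_comp hi hfst.
  exact: computable_nat_usnd computable_nat_id.
exists (fun z => if d z == 0%N then 0%N else (W (npair (ufst z) (ufst (d z).-1))).+1).
  apply: computable_nat_if; first exact: computable_pred_eq0.
    exact: computable_nat_const.
  apply: computable_nat_succ; apply: computable_nat_comp hW _.
  apply: computable_nat_npair => //; apply: computable_nat_ufst.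
  exact: computable_nat_comp computable_nat_pred hd.
move=> p t; have dE j : d (npair t (enc_list (mkseq p j))) =
    enc_list (drop (idx t) (mkseq p j)).
  by rewrite /d ufst_npair usnd_npair iter_code_tail.
exists (idx t).+1; split=> [j jt|].
  by rewrite dE drop_oversize // size_mkseq.
rewrite dE (drop_nth 0%N) ?size_mkseq // nth_mkseq //=.
by rewrite !ufst_npair.
Qed.

(** * Rational-valued computable functions and decoding *)

(** The numerator is a difference of naturals and the denominator a successor, so that signs and
    division by zero need no case distinctions. *)
Definition computable_rat (F : nat -> Rl) : Prop :=
  exists P N D : nat -> nat,
    [/\ computable_nat P, computable_nat N, computable_nat D &
        forall e, F e = ((P e)%:R - (N e)%:R) / (D e).+1%:R].

Lemma eq_computable_rat F G : F =1 G -> computable_rat F -> computable_rat G.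
Proof. by move=> FG [P [N [D [? ? ? FE]]]]; exists P, N, D; split => // e; rewrite -FG. Qed.

Lemma computable_rat_frac f h : computable_nat f -> computable_nat h ->
  computable_rat (fun e => (f e)%:R / (h e).+1%:R).
Proof.
move=> hf hh; exists f, (fun=> 0%N), h; split => //; first exact: computable_nat_const.
by move=> e; rewrite subr0.
Qed.

Lemma computable_rat_nat f : computable_nat f -> computable_rat (fun e => (f e)%:R).
Proof.
move=> hf; apply: eq_computable_rat
  (computable_rat_frac hf (computable_nat_const 0)) => e.
by rewrite divr1.
Qed.

Lemma computable_rat_opp F : computable_rat F -> computable_rat (fun e => - F e).
Proof.
move=> [P [N [D [? ? ? FE]]]]; exists N, P, D; split => // e.
by rewrite FE -mulNr opprB.
Qed.

Lemma computable_rat_add F G : computable_rat F -> computable_rat G ->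
  computable_rat (fun e => F e + G e).
Proof.
move=> [P [N [D [hP hN hD FE]]]] [P' [N' [D' [hP' hN' hD' GE]]]].
exists (fun e => P e * (D' e).+1 + P' e * (D e).+1)%N,
  (fun e => N e * (D' e).+1 + N' e * (D e).+1)%N,
  (* This is the predecessor of the product of the two denominators. *)
  (fun e => (D e) * (D' e).+1 + D' e)%N.
split; do ?[apply: computable_nat_add | apply: computable_nat_mul |
  apply: computable_nat_succ] => // e.
rewrite FE GE -addnS -mulSnr !natrD !natrM.
have h1 : (D e).+1%:R != 0 :> Rl by rewrite pnatr_eq0.
have h2 : (D' e).+1%:R != 0 :> Rl by rewrite pnatr_eq0.
by move: (D e).+1%:R (D' e).+1%:R h1 h2 => d d' h1 h2; field; rewrite h1 h2.
Qed.

Lemma computable_rat_mul F G : computable_rat F -> computable_rat G ->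
  computable_rat (fun e => F e * G e).
Proof.
move=> [P [N [D [hP hN hD FE]]]] [P' [N' [D' [hP' hN' hD' GE]]]].
exists (fun e => P e * P' e + N e * N' e)%N,
  (fun e => P e * N' e + N e * P' e)%N,
  (fun e => (D e) * (D' e).+1 + D' e)%N.
split; do ?[apply: computable_nat_add | apply: computable_nat_mul |
  apply: computable_nat_succ] => // e.
rewrite FE GE -addnS -mulSnr !natrD !natrM.
have h1 : (D e).+1%:R != 0 :> Rl by rewrite pnatr_eq0.
have h2 : (D' e).+1%:R != 0 :> Rl by rewrite pnatr_eq0.
by move: (D e).+1%:R (D' e).+1%:R h1 h2 => d d' h1 h2; field; rewrite h1 h2.
Qed.

Lemma computable_rat_norm F : computable_rat F -> computable_rat (fun e => `|F e|).
Proof.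
move=> [P [N [D [hP hN hD FE]]]].
(* With truncated subtraction one of the two summands is 0 and the other is the absolute value. *)
exists (fun e => (P e - N e) + (N e - P e))%N, (fun=> 0%N), D.
split; do ?[apply: computable_nat_add | apply: computable_nat_sub |
  exact: computable_nat_const] => // e.
rewrite FE subr0 normrM normfV normr_nat natrD; congr (_ / _).
have [h|/ltnW h] := leqP (N e) (P e).
  by rewrite -natrB // normr_nat (eqP h : (_ - _ = 0)%N) addr0.
by rewrite distrC -natrB // normr_nat (eqP h : (_ - _ = 0)%N) add0r.
Qed.

Lemma computable_rat_sum k (F : 'I_k -> nat -> Rl) :
  (forall i, computable_rat (F i)) -> computable_rat (fun e => \sum_i F i e).
Proof.
move=> hF.
have h s : computable_rat (fun e => \sum_(i <- s) F i e).
  elim: s => [|i s IH].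
    apply: eq_computable_rat (computable_rat_nat (computable_nat_const 0)) => e.
    by rewrite big_nil.
  apply: eq_computable_rat (computable_rat_add (hF i) IH) => e.
  by rewrite big_cons.
exact: h.
Qed.

Lemma computable_rat_exp2V f :
  computable_nat f -> computable_rat (fun e => (2 ^+ f e)^-1).
Proof.
move=> /computable_nat_exp2 hf; have hp := computable_nat_comp computable_nat_pred hf.
apply: eq_computable_rat (computable_rat_frac (computable_nat_const 1) hp) => e.
by rewrite /= prednK ?expn_gt0 // mul1r natrX.
Qed.

Lemma computable_pred_ler F G : computable_rat F -> computable_rat G ->
  computable_pred (fun e => F e <= G e).
Proof.
move=> [P [N [D [hP hN hD FE]]]] [P' [N' [D' [hP' hN' hD' GE]]]].
have : computable_pred (fun e => P e * (D' e).+1 + N' e * (D e).+1 <=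
    P' e * (D e).+1 + N e * (D' e).+1)%N.
  by apply: computable_pred_leq; do ?[apply: computable_nat_add |
    apply: computable_nat_mul | apply: computable_nat_succ].
apply: eq_computable_nat => e; congr nat_of_bool.
rewrite FE GE ler_pdivrMr ?ltr0Sn // mulrAC ler_pdivlMr ?ltr0Sn //.
by rewrite !mulrBl lerBlDr addrAC lerBrDr -!natrM -!natrD ler_nat.
Qed.

Lemma computable_pred_ltr F G : computable_rat F -> computable_rat G ->
  computable_pred (fun e => F e < G e).
Proof.
move=> hF hG; apply: eq_computable_nat
  (computable_predN (computable_pred_ler hG hF)) => e.
by rewrite -ltNge.
Qed.

Definition int_of_code (k : nat) : int := if odd k then Negz k./2 else Posz k./2.

Lemma int_of_codeK k : enc_int (int_of_code k) = k.
Proof.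
rewrite -[RHS](odd_double_half k) /int_of_code; by case: (odd k).
Qed.

Lemma enc_intK z : int_of_code (enc_int z) = z.
Proof.
case: z => k; rewrite /int_of_code /= ?odd_double ?doubleK //.
by rewrite uphalf_double.
Qed.

Definition rat_of_code (x : nat) : rat_code := (int_of_code (ufst x), usnd x).

Lemma rat_of_codeK x : enc_rat (rat_of_code x) = x.
Proof. by rewrite /enc_rat /= int_of_codeK npair_unpair. Qed.

Lemma enc_ratK q : rat_of_code (enc_rat q) = q.
Proof. by case: q => a b; rewrite /rat_of_code /enc_rat /= ufst_npair usnd_npair enc_intK. Qed.

Definition code_val (i t : nat) : Rl := rat_val (rat_of_code (code_nth i t)).

Lemma computable_rat_code_val h f : computable_nat h -> computable_nat f ->
  computable_rat (fun e => code_val (h e) (f e)).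
Proof.
move=> hh hf; have hx := computable_nat_code_nth hh hf.
have [ho hl] := computable_nat_half (computable_nat_ufst hx).
exists (fun e => (ufst (code_nth (h e) (f e)))./2 *
                 (1 - odd (ufst (code_nth (h e) (f e)))))%N,
  (fun e => (ufst (code_nth (h e) (f e)))./2.+1 *
                 (odd (ufst (code_nth (h e) (f e)))))%N,
  (fun e => usnd (code_nth (h e) (f e))).
split.
- exact: computable_nat_mul hl (computable_nat_sub (computable_nat_const 1) ho).
- exact: computable_nat_mul (computable_nat_succ hl) ho.
- exact: computable_nat_usnd.
move=> e; rewrite /code_val /rat_val /= /int_of_code; congr (_ / _).
case: (odd _) => /=; first by rewrite muln0 muln1 NegzE mulrNz sub0r.
by rewrite muln0 muln1 subr0.
Qed.

Definition code_vec (k t : nat) : seq rat_code :=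
  mkseq (fun i => rat_of_code (code_nth i t)) k.

Lemma computable_nat_code_vec k f : computable_nat f ->
  computable_nat (fun e => enc_qvec (code_vec k (f e))).
Proof.
move=> hf; apply: eq_computable_nat (@computable_nat_enc_list nat
  (fun i e => code_nth i (f e)) (iota 0 k) _) => [e|i].
  congr enc_list; rewrite /code_vec -map_comp; apply: eq_map => i /=.
  by rewrite rat_of_codeK.
by apply: computable_nat_code_nth => //; exact: computable_nat_const.
Qed.

Lemma code_val_enc i qs :
  (i < size qs)%N -> code_val i (enc_qvec qs) = rat_val (nth q0 qs i).
Proof.
move=> h; rewrite /code_val /enc_qvec code_nth_enc ?size_map //.
by rewrite (nth_map q0) // enc_ratK.
Qed.

Lemma nth_code_vec k t i :
  (i < k)%N -> rat_val (nth q0 (code_vec k t) i) = code_val i t.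
Proof. by move=> h; rewrite nth_mkseq. Qed.

Lemma rat_val_dense (x e : Rl) : 0 < e -> exists q, `|x - rat_val q| <= e.
Proof.
move=> e0.
have [k hk] : exists k, e^-1 <= k.+1%:R.
  by exists (Num.truncn e^-1); rewrite ltW // truncnS_gt.
have k0 : 0 < k.+1%:R :> Rl by rewrite ltr0Sn.
exists (Num.floor (x * k.+1%:R), k); rewrite /rat_val /=.
have -> : x - (Num.floor (x * k.+1%:R))%:~R / k.+1%:R =
   (x * k.+1%:R - (Num.floor (x * k.+1%:R))%:~R) / k.+1%:R.
  by rewrite mulrBl mulfK // gt_eqF.
have /andP[h1 h2] := real_floor_itv (num_real (x * k.+1%:R)).
rewrite normrM ger0_norm ?subr_ge0 // normfV normr_nat.
rewrite ler_pdivrMr // (le_trans (y := 1)) //.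
  by rewrite intrD in h2; lra.
by rewrite mulrC -ler_pdivrMr // mul1r.
Qed.

(* Certificates are evaluated on constant names of rational points: the finite
   prefix of length [l e] read by the associate is then also a prefix of a name
   of every point within [2 ^- l e]. *)
Lemma computable_eval n (Y : Type) (F : 'rV[Rl]_n -> Y)
    (named : Y -> (nat -> nat) -> Prop) alpha (c N : nat -> nat) :
  computable_nat alpha ->
  (forall x p, vec_name x p -> exists q, runs alpha p q /\ named (F x) q) ->
  computable_nat c -> computable_nat N ->
  exists l v : nat -> nat, [/\ computable_nat l, computable_nat v &
    forall e (z : 'rV[Rl]_n),
    (forall i : 'I_n, `|z ord0 i - code_val i (c e)| <= (2 ^+ l e)^-1) ->
    exists q, named (F z) q /\ q (N e) = v e].
Proof.
move=> ha aP hc hN; pose C e := enc_qvec (code_vec n (c e)).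
pose val k e := alpha (npair (N e) (enc_list (nseq k (C e)))).
have nameC e : vec_name (\row_(i < n) code_val i (c e)) (fun=> C e).
  move=> k; exists (code_vec n (c e)); split; first by rewrite size_mkseq.
  split => // i; rewrite nth_code_vec // mxE subrr normr0 invr_ge0 exprn_ge0 //.
have mkC e j : mkseq (fun=> C e) j = nseq j (C e).
  by rewrite /mkseq; elim: j 0%N => //= j IH s; rewrite IH.
have /choice[l lP] e : exists k, val k e <> 0%N /\ forall j, (j < k)%N -> val j e = 0%N.
  have [q [/(_ (N e)) [k [k0 kv]] _]] := aP _ _ (nameC e).
  exists k; rewrite /val -mkC kv; split => // j jk; rewrite -mkC; exact: k0.
have hval f h : computable_nat f -> computable_nat h ->
    computable_nat (fun e => val (h e) (f e)).
  move=> hf hh; apply: computable_nat_comp ha _.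
  apply: computable_nat_npair; first exact: computable_nat_comp.
  apply: computable_nat_enc_nseq => //; apply: computable_nat_code_vec.
  exact: computable_nat_comp.
have hl : computable_nat l.
  apply: (@computable_nat_min (fun k e => 1 - val k e)%N) => [|e].
    apply: computable_nat_sub; first exact: computable_nat_const.
    by apply: hval; [apply: computable_nat_usnd|apply: computable_nat_ufst];
      exact: computable_nat_id.
  have [l0 lj] := lP e; split; first by case: (val _ _) l0.
  by move=> j /lj ->.
exists l, (fun e => (val (l e) e).-1); split => //.
  apply: computable_nat_comp computable_nat_pred _.
  exact: hval computable_nat_id hl.
move=> e z zc; have [l0 lj] := lP e.
have /choice[app appP] j : exists qs : seq rat_code, size qs = n /\
    forall i : 'I_n, `|z ord0 i - rat_val (nth q0 qs i)| <= (2 ^+ j)^-1.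
  have /choice[q qP] : forall i : 'I_n, exists q,
      `|z ord0 i - rat_val q| <= (2 ^+ j)^-1.
    by move=> i; apply: rat_val_dense; rewrite invr_gt0 exprn_gt0.
  exists [seq q i | i <- enum 'I_n]; rewrite size_map size_enum_ord; split => // i.
  by rewrite (nth_map i) ?size_enum_ord // nth_ord_enum.
(* A name of [z] that starts like the constant name of the rational point. The associate answers
   within [l e] entries, hence gives both names the same value at [N e]. *)
pose p j := if (j <= l e)%N then C e else enc_qvec (app j).
have pname : vec_name z p.
  move=> j; rewrite /p; case: leqP => [jl|_]; last first.
    by have [? ?] := appP j; exists (app j).
  exists (code_vec n (c e)); rewrite size_mkseq; split => //; split => // i.
  rewrite nth_code_vec // (le_trans (zc i)) // lef_pV2 ?posrE ?exprn_gt0 //.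
  by rewrite ler_weXn2l // ler1n.
have [q [qr qn]] := aP _ _ pname; exists q; split => //.
have mkp j : (j <= l e)%N -> mkseq p j = nseq j (C e).
  move=> jl; rewrite -mkC; apply/eq_in_map => i.
  rewrite mem_iota /p add0n => /andP[_ ij]; by rewrite (leq_trans (ltnW ij)).
have [k [k0 kv]] := qr (N e).
have kl : k = l e.
  apply/eqP; rewrite eqn_leq; apply/andP; split; rewrite leqNgt; apply/negP => h.
    by apply: l0; rewrite /val -mkp //; exact: k0.
  by have := lj _ h; rewrite /val -mkp 1?ltnW // kv.
by rewrite /val -mkp // -kl kv.
Qed.

(** * Mean value inequality *)

Section EntrywiseNorm.
Variable R : realType.

Lemma mx_norm_le m n (A : 'M[R]_(m, n)) C :
  0 <= C -> (forall i j, `|A i j| <= C) -> `|A| <= C.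
Proof.
move=> C0 AC; rewrite [leLHS]/Num.Def.normr /= mx_normrE.
by apply: bigmax_le => // -[i j] _; exact: AC.
Qed.

Lemma mx_entry_le m n (A : 'M[R]_(m, n)) i j : `|A i j| <= `|A|.
Proof.
rewrite [leRHS]/Num.Def.normr /= mx_normrE.
by apply: (bigmax_sup (i, j)).
Qed.

(** Unlike the entrywise maximum, this norm is submultiplicative; it bounds the action on row
    vectors in the maximum norm, and on rational matrices it is a rational that the machine can
    compute. *)
Definition l1 m n (A : 'M[R]_(m, n)) : R := \sum_i \sum_j `|A i j|.

Lemma l1_ge0 m n (A : 'M[R]_(m, n)) : 0 <= l1 A.
Proof. by apply: sumr_ge0 => i _; apply: sumr_ge0 => j _. Qed.

Lemma l1D m n (A B : 'M[R]_(m, n)) : l1 (A + B) <= l1 A + l1 B.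
Proof.
rewrite /l1 -big_split; apply: ler_sum => i _; rewrite -big_split.
by apply: ler_sum => j _; rewrite mxE ler_normD.
Qed.

Lemma l1_mul m n p (A : 'M[R]_(m, n)) (B : 'M[R]_(n, p)) :
  l1 (A *m B) <= l1 A * l1 B.
Proof.
rewrite /l1 mulr_suml; apply: ler_sum => i _.
apply: (@le_trans _ _ (\sum_k \sum_j `|A i j| * `|B j k|)).
  apply: ler_sum => k _; rewrite mxE; apply: le_trans (ler_norm_sum _ _ _) _.
  by apply: ler_sum => j _; rewrite normrM.
rewrite exchange_big mulr_suml /=; apply: ler_sum => j _.
rewrite -mulr_sumr ler_wpM2l //.
rewrite [leRHS](bigD1 j) //= lerDl.
by apply: sumr_ge0 => a _; apply: sumr_ge0.
Qed.

Lemma l1_le_norm m n (A : 'M[R]_(m, n)) : l1 A <= (m * n)%:R * `|A|.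
Proof.
have -> : (m * n)%:R * `|A| = \sum_(i < m) \sum_(j < n) `|A|.
  by rewrite !sumr_const !card_ord -mulrnA mulr_natl mulnC.
by apply: ler_sum => i _; apply: ler_sum => j _; exact: mx_entry_le.
Qed.

Lemma norm_mulmx_le m n (v : 'rV[R]_m) (A : 'M[R]_(m, n)) : `|v *m A| <= `|v| * l1 A.
Proof.
apply: mx_norm_le => [|i j]; first by rewrite mulr_ge0 ?l1_ge0.
rewrite mxE; apply: le_trans (ler_norm_sum _ _ _) _.
rewrite /l1 mulr_sumr; apply: ler_sum => k _; rewrite normrM.
apply: ler_pM => //; first exact: mx_entry_le.
by rewrite (bigD1 j) //= lerDl sumr_ge0.
Qed.

(** If [v *m E = 0] then [v] equals [- v *m (E - 1%:M)], whose norm is at most half that of [v]. *)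
Lemma l1_half_row_free r (E : 'M[R]_r) : l1 (E - 1%:M) <= 2^-1 -> row_free E.
Proof.
move=> hE; rewrite -kermx_eq0; apply/eqP/row_matrixP => i; rewrite row0.
set v := row i _.
have vE : v *m E = 0 by apply/sub_kermxP; exact: row_sub.
have := norm_mulmx_le v (E - 1%:M).
rewrite mulmxBr vE mulmx1 sub0r normrN => hv.
have : `|v| <= `|v| * 2^-1 by apply: le_trans hv _; exact: ler_wpM2l.
move=> h; apply/eqP; rewrite -normr_le0; lra.
Qed.

End EntrywiseNorm.

Section MeanValue.
Variable R : realType.

(** Let [t] be the supremum of the times up to which growth at rate [C + e] is respected. The local
    bound on the left of [t] shows that [t] is such a time; on the right it would go beyond [t]
    unless [t = 1]. *)
Lemma mean_value_le (V : normedModType R) (f : R -> V) C : 0 <= C ->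
  (forall t : R, 0 <= t <= 1 -> forall e : R, 0 < e -> exists2 d : R, 0 < d &
     forall s : R, 0 <= s <= 1 -> `|s - t| <= d -> `|f s - f t| <= (C + e) * `|s - t|) ->
  `|f 1 - f 0| <= C.
Proof.
move=> C0 hf; apply/ler_addgt0Pr => e e0.
pose S := [set t : R | 0 <= t <= 1 /\ `|f t - f 0| <= (C + e) * t].
have S0 : S 0 by split; rewrite ?lexx ?ler01 // subrr normr0 mulr0.
have Sub : ubound S 1 by move=> t [/andP[]].
have hS : has_sup S by split; [exists 0 | exists 1].
set t := sup S.
have tub s : S s -> s <= t by apply: ub_le_sup; exists 1.
have t0 : 0 <= t := tub _ S0.
have t1 : t <= 1 by apply: ge_sup => //; exists 0.
have [|d d0 hd] := hf t _ e e0; first by rewrite t0.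
have St : S t.
  split; first by rewrite t0.
  have [s [s01 fs] ts] := sup_adherent d0 hS.
  have st : s <= t by apply: tub; split.
  have std : t - s <= d by rewrite -/t in ts; lra.
  have := hd s s01; rewrite [`|s - t|]distrC ger0_norm ?subr_ge0 //.
  move=> /(_ std); rewrite distrC => h; rewrite -[f t](subrK (f s)) -addrA.
  apply: le_trans (ler_normD _ _) _; nra.
have [t_eq1|t_neq1] := eqVneq t 1.
  by have [_] := St; rewrite t_eq1 mulr1.
have tlt1 : t < 1 by rewrite lt_neqAle t_neq1.
exfalso; pose s := Num.min 1 (t + d).
have ts : t < s by rewrite lt_min tlt1 ltrDl.
have s1 : s <= 1 by rewrite ge_min lexx.
have sd : s <= t + d by rewrite ge_min lexx orbT.
have : S s.
  split; first by rewrite s1 andbT; lra.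
  have s01 : 0 <= s <= 1 by rewrite s1 andbT; lra.
  have std : s - t <= d by lra.
  have := hd s s01; rewrite [`|s - t|]ger0_norm; last by rewrite subr_ge0 ltW.
  move=> /(_ std) h; have [_ ht] := St.
  rewrite -[f s](subrK (f t)) -addrA.
  apply: le_trans (ler_normD _ _) _; nra.
by move=> /tub; lra.
Qed.

(** Increments are row vectors acting from the left, so [A] is the transpose of the usual Jacobian
    matrix. *)
Definition frechet n m (f : 'rV[R]_n -> 'rV[R]_m) (x : 'rV[R]_n) (A : 'M[R]_(n, m)) :=
  forall e : R, 0 < e -> exists2 d : R, 0 < d &
    forall z, `|z - x| <= d -> `|f z - f x - (z - x) *m A| <= e * `|z - x|.

Lemma differentiable_frechet n m (f : 'rV[R]_n -> 'rV[R]_m) x A :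
  differentiable f x -> (forall v, 'd f x v = v *m A) -> frechet f x A.
Proof.
move=> /diff_locally /eqaddoP /[swap] fA h e e0.
have /nbhs_normP [d /= d0 hd] := h _ e0.
exists (d / 2); first by rewrite divr_gt0.
move=> z zd; have := hd (z - x); rewrite /ball_ /= sub0r normrN.
rewrite !fctE /= fA subrK opprD addrA; apply.
by rewrite (le_lt_trans zd) // ltr_pdivrMr // mulr_natr mulr2n ltrDl.
Qed.

Lemma frechet_mulmxr n m p (f : 'rV[R]_n -> 'rV[R]_m) x A (P : 'M[R]_(m, p)) :
  frechet f x A -> frechet (fun z => f z *m P) x (A *m P).
Proof.
move=> hf e e0.
have c0 : 0 < l1 P + 1 by rewrite ltr_wpDl ?l1_ge0.
have [d d0 hd] := hf (e / (l1 P + 1)) (divr_gt0 e0 c0).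
exists d => // z /hd h; rewrite mulmxA -!mulmxBl.
apply: le_trans (norm_mulmx_le _ _) _.
apply: (@le_trans _ _ (e / (l1 P + 1) * `|z - x| * (l1 P + 1))).
  by apply: ler_pM => //; [exact: l1_ge0 | rewrite lerDl].
by rewrite mulrAC divfK // gt_eqF.
Qed.

Lemma frechet_affine_sub n r (f : 'rV[R]_n -> 'rV[R]_r) x (B : 'M[R]_(r, n)) w A :
  frechet f (x + w *m B) A ->
  frechet (fun w => f (x + w *m B) - w) w (B *m A - 1%:M).
Proof.
move=> hf e e0.
have c0 : 0 < l1 B + 1 by rewrite ltr_wpDl ?l1_ge0.
have [d d0 hd] := hf (e / (l1 B + 1)) (divr_gt0 e0 c0).
exists (d / (l1 B + 1)); first exact: divr_gt0.
move=> z zw.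
have E : x + z *m B - (x + w *m B) = (z - w) *m B.
  by rewrite mulmxBl opprD addrACA subrr add0r.
have hn : `|(z - w) *m B| <= `|z - w| * (l1 B + 1).
  apply: le_trans (norm_mulmx_le _ _) _.
  by rewrite ler_wpM2l // lerDl.
have := hd (x + z *m B); rewrite E => /(_ _).
rewrite (le_trans hn) -?ler_pdivlMr // => /(_ erefl) h.
have -> : f (x + z *m B) - z - (f (x + w *m B) - w) - (z - w) *m (B *m A - 1%:M)
   = f (x + z *m B) - f (x + w *m B) - (z - w) *m B *m A.
  rewrite mulmxBr mulmx1 mulmxA.
  move: (f (x + z *m B)) (f (x + w *m B)) (_ *m A) => a b c.
  by apply/rowP => j; rewrite !mxE; ring.
apply: le_trans h _.
apply: (@le_trans _ _ (e / (l1 B + 1) * (`|z - w| * (l1 B + 1)))).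
  by rewrite ler_wpM2l // divr_ge0 // ltW.
by rewrite mulrA mulrAC divfK // gt_eqF.
Qed.

Lemma frechet_lipschitz n m (f : 'rV[R]_n -> 'rV[R]_m) z z' C
    (D : R -> 'M[R]_(n, m)) : 0 <= C ->
  (forall t, 0 <= t <= 1 -> frechet f (z' + t *: (z - z')) (D t) /\ l1 (D t) <= C) ->
  `|f z - f z'| <= C * `|z - z'|.
Proof.
move=> C0 hD; pose k := `|z - z'|; have k0 : 0 <= k := normr_ge0 _.
have := @mean_value_le _ (fun t => f (z' + t *: (z - z'))) (C * k).
rewrite scale1r scale0r addr0 [z' + _]addrC subrK; apply; first exact: mulr_ge0.
move=> t t01 e e0; have [ft Dt] := hD t t01.
have k1 : 0 < k + 1 by rewrite ltr_wpDl.
have [d d0 hd] := ft (e / (k + 1)) (divr_gt0 e0 k1).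
exists (d / (k + 1)); first exact: divr_gt0.
move=> s s01 st; have := hd (z' + s *: (z - z')).
have -> : z' + s *: (z - z') - (z' + t *: (z - z')) = (s - t) *: (z - z').
  by rewrite scalerBl opprD addrACA subrr add0r.
rewrite normrZ -/k; set a := `|s - t| in st *.
have a0 : 0 <= a := normr_ge0 _.
have ak : a * k <= a * (k + 1) by rewrite ler_wpM2l // lerDl.
rewrite (le_trans ak) -?ler_pdivlMr // => /(_ erefl) h.
set F := f _ - f _ in h *; set v := (s - t) *: _ *m _ in h.
rewrite -[F](subrK v); apply: le_trans (ler_normD _ _) _.
have hv : `|v| <= a * k * C.
  apply: le_trans (norm_mulmx_le _ _) _.
  by rewrite normrZ ler_wpM2l // mulr_ge0.
have h' : e / (k + 1) * (a * k) <= e * a.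
  rewrite mulrAC ler_pdivrMr // -mulrA; apply: ler_wpM2l => //; exact: ltW.
have -> : (C * k + e) * a = e * a + a * k * C by ring.
exact: lerD (le_trans h h') hv.
Qed.

End MeanValue.

(** * Quantitative surjectivity *)

Section Contraction.
Variable R : realType.

Lemma open_norm_ball (V : normedModType R) (U : set V) x : open U -> U x ->
  exists2 d : R, 0 < d & forall z, `|z - x| <= d -> U z.
Proof.
move=> oU Ux; have /nbhs_normP [d /= d0 hd] : nbhs x U by exact: open_nbhs_nbhs.
exists (d / 2); first by rewrite divr_gt0.
move=> z zx; apply: hd; rewrite /ball_ /= distrC (le_lt_trans zx) //.
by rewrite ltr_pdivrMr // mulr_natr mulr2n ltrDl.
Qed.

Lemma continuous_l1 n m p (A : 'rV[R]_n -> 'M[R]_(m, p)) x (e : R) :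
  {for x, continuous A} -> 0 < e ->
  exists2 d : R, 0 < d & forall z, `|z - x| <= d -> l1 (A z - A x) <= e.
Proof.
move=> /cvgrPdist_le hA e0.
have c0 : 0 < (m * p)%:R + 1 :> R by rewrite ltr_wpDl.
have /nbhs_normP [d /= d0 hd] := hA _ (divr_gt0 e0 c0).
exists (d / 2); first by rewrite divr_gt0.
move=> z zx; have /hd : ball_ Num.Def.normr x d z.
  rewrite /ball_ /= distrC (le_lt_trans zx) //.
  by rewrite ltr_pdivrMr // mulr_natr mulr2n ltrDl.
rewrite /= distrC => h; apply: le_trans (l1_le_norm _) _.
apply: (@le_trans _ _ (((m * p)%:R + 1) * (e / ((m * p)%:R + 1)))).
  by apply: ler_pM => //; rewrite lerDl.
by rewrite mulrCA divff ?mulr1 // gt_eqF.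
Qed.

Lemma frechet_continuous n m (f : 'rV[R]_n -> 'rV[R]_m) x A :
  frechet f x A -> {for x, continuous f}.
Proof.
move=> hf; apply/(@cvgrPdist_le _ _ _ (nbhs x)) => e e0.
have [d d0 hd] := hf 1 ltr01; set k := 1 + l1 A.
have k0 : 0 < k by rewrite ltr_wpDr ?l1_ge0.
suff : \forall z \near x, `|f x - f z| <= e by [].
apply/nbhs_normP; exists (Num.min d (e / k)); first by rewrite /= lt_min d0 divr_gt0.
move=> z; rewrite /ball_ /= lt_min distrC => /andP[/ltW zd /ltW ze].
rewrite distrC -[f z - f x](subrK ((z - x) *m A)).
apply: le_trans (ler_normD _ _) _.
apply: le_trans (lerD (hd _ zd) (norm_mulmx_le _ _)) _.
by rewrite mul1r -{1}[`|z - x|]mulr1 -mulrDr -ler_pdivlMr.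
Qed.

Lemma norm_ball_convex (V : normedModType R) (c z z' : V) (d t : R) :
  0 <= t <= 1 -> `|z - c| <= d -> `|z' - c| <= d -> `|z' + t *: (z - z') - c| <= d.
Proof.
move=> /andP[t0 t1] hz hz'.
have -> : z' + t *: (z - z') - c = (1 - t) *: (z' - c) + t *: (z - c).
  rewrite scalerBl scale1r -[RHS]addrA [- _ + _]addrC -scalerBr.
  have -> : z - c - (z' - c) = z - z' by rewrite opprB addrA subrK.
  by rewrite addrAC.
apply: le_trans (ler_normD _ _) _; rewrite !normrZ !ger0_norm ?subr_ge0 //.
have -> : d = (1 - t) * d + t * d by ring.
by apply: lerD; apply: ler_wpM2l => //; rewrite subr_ge0.
Qed.

Lemma contraction_bound n r (f : 'rV[R]_n -> 'rV[R]_r) f' (c : 'rV[R]_n) (d : R)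
    (B : 'M[R]_(r, n)) (x : 'rV[R]_n) (w w' : 'rV[R]_r) :
  (forall z, frechet f z (f' z)) ->
  (forall z, `|z - c| <= d -> l1 (B *m f' z - 1%:M) <= 2^-1) ->
  `|x + w *m B - c| <= d -> `|x + w' *m B - c| <= d ->
  `|f (x + w *m B) - f (x + w' *m B) - (w - w')| <= 2^-1 * `|w - w'|.
Proof.
move=> ff hB hw hw'.
have := @frechet_lipschitz R _ _ (fun w => f (x + w *m B) - w) w w' 2^-1
  (fun t => B *m f' (x + (w' + t *: (w - w')) *m B) - 1%:M).
have -> : f (x + w *m B) - w - (f (x + w' *m B) - w') =
    f (x + w *m B) - f (x + w' *m B) - (w - w').
  move: (f (x + w *m B)) (f (x + w' *m B)) => a b.
  by apply/rowP => j; rewrite !mxE; ring.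
apply => [|t t01]; first by rewrite invr_ge0.
split; first exact: frechet_affine_sub.
apply: hB; have -> : x + (w' + t *: (w - w')) *m B =
    x + w' *m B + t *: (x + w *m B - (x + w' *m B)).
  rewrite mulmxDl -scalemxAl mulmxBl; move: (w *m B) (w' *m B) => a b.
  by apply/rowP => j; rewrite !mxE; ring.
exact: norm_ball_convex.
Qed.

(** Triangle inequality: the increment of [f] differs from [w - w'] by at most half of its norm.
    This gives uniqueness and Lipschitz dependence of solutions. *)
Lemma contraction_expand n r (f : 'rV[R]_n -> 'rV[R]_r) f' (c : 'rV[R]_n) (d : R)
    (B : 'M[R]_(r, n)) (x : 'rV[R]_n) (w w' : 'rV[R]_r) :
  (forall z, frechet f z (f' z)) ->
  (forall z, `|z - c| <= d -> l1 (B *m f' z - 1%:M) <= 2^-1) ->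
  `|x + w *m B - c| <= d -> `|x + w' *m B - c| <= d ->
  `|w - w'| <= 2 * `|f (x + w *m B) - f (x + w' *m B)|.
Proof.
move=> ff hB hw hw'; have := contraction_bound ff hB hw hw'.
set F := f _ - f _ => h.
have : `|w - w'| <= `|F| + `|F - (w - w')|.
  by rewrite -{1}[w - w'](subKr F); exact: ler_normB.
lra.
Qed.

(* A minimizer [w] of the distance from [f (x + w B)] to [y] must be a zero, as the
   quasi-Newton step [w + (y - f (x + w B))] halves that distance. *)
Lemma contraction_solve n r (f : 'rV[R]_n -> 'rV[R]_r) f' (c : 'rV[R]_n) (d s : R)
    (B : 'M[R]_(r, n)) (x : 'rV[R]_n) (y : 'rV[R]_r) :
  (forall z, frechet f z (f' z)) ->
  (forall z, `|z - c| <= d -> l1 (B *m f' z - 1%:M) <= 2^-1) ->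
  0 <= s -> (forall w, `|w| <= s -> `|x + w *m B - c| <= d) ->
  `|f x - y| <= s / 2 -> exists2 w, `|w| <= s & f (x + w *m B) = y.
Proof.
move=> ff hB s0 hw fxy; pose K := closed_ball_ Num.Def.normr (0 : 'rV[R]_r) s.
have KE w : K w <-> `|w| <= s by rewrite /K /closed_ball_ /= sub0r normrN.
have cK : compact K.
  apply: bounded_closed_compact; last exact: closed_closed_ball_.
  exists s; split; first exact: num_real.
  by move=> M sM w /KE ws; exact: le_trans ws (ltW sM).
pose h (w : 'rV[R]_r) := `|f (x + w *m B) - y|.
have ch : continuous h.
  move=> w; suff cF : {for w, continuous (fun w : 'rV[R]_r => f (x + w *m B) - y)}.
    exact: cvg_norm cF.
  (* The derivative is known for the map with [w] subtracted, so continuity is read off there and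
     [w] is added back. *)
  have -> : (fun w : 'rV[R]_r => f (x + w *m B) - y) =
      (fun w : 'rV[R]_r => (f (x + w *m B) - w) + (w - y)).
    by apply/funext => v; rewrite addrA subrK.
  have cI : {for w, continuous (fun v : 'rV[R]_r => v - y)}.
    by apply: continuousB; [move=> P | exact: cst_continuous].
  apply: (fun h => continuousD h cI).
  exact: frechet_continuous (frechet_affine_sub (ff _)).
have K0 : K 0 by apply/KE; rewrite normr0.
have [w] := compact_EVT_min (ex_intro _ 0 K0) cK (continuous_subspaceT ch).
rewrite inE => /KE ws wmin; exists w => //.
pose w' := w + (y - f (x + w *m B)).
(* The Newton step stays in the ball: half of [s] pays for the contraction error between [w] and 0,
   the other half for the distance from [f x] to [y]. *)
have w's : `|w'| <= s.
  have := contraction_bound ff hB (hw w ws) (hw 0 _).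
  rewrite normr0 mul0mx addr0 subr0 => /(_ s0) h1.
  have -> : w' = - (f (x + w *m B) - f x - w) - (f x - y).
    rewrite /w'; move: (f (x + w *m B)) (f x) => a b; by apply/rowP => j; rewrite !mxE; ring.
  apply: le_trans (ler_normB _ _) _; rewrite normrN; lra.
have := wmin w'; rewrite inE => /(_ ltac:(exact/KE)).
have := contraction_bound ff hB (hw w' w's) (hw w ws).
have -> : f (x + w' *m B) - f (x + w *m B) - (w' - w) = f (x + w' *m B) - y.
  rewrite [in - (w' - w)]/w'; move: (f (x + w' *m B)) (f (x + w *m B)) => a b.
  by apply/rowP => j; rewrite !mxE; ring.
have -> : w' - w = y - f (x + w *m B) by rewrite /w' addrC addrA addNr add0r.
rewrite [`|y - _|]distrC -/(h w) -/(h w') => h1 h2.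
have : h w <= 0 by lra.
by rewrite normr_le0 subr_eq0 => /eqP.
Qed.

(** In the rank factorization [col_base A *m row_base A] the first factor has a left inverse and the
    second a right inverse. *)
Lemma rank_factor n m (A : 'M[R]_(n, m)) :
  exists (B : 'M[R]_(\rank A, n)) (P : 'M[R]_(m, \rank A)), B *m A *m P = 1%:M.
Proof.
exists (pinvmx (col_base A)), (pinvmx (row_base A)).
have := congr1 (mulmx (pinvmx (col_base A))) (mulmx_base A).
rewrite mulmxA mulVpmx ?col_base_full // mul1mx => <-.
by rewrite mulmxVp // row_base_free.
Qed.

(** The columns of [A *m P] lie in the column space of [A]; as no rank is lost, the two spaces
    agree. *)
Lemma rank_mulmx_factor n m p (A : 'M[R]_(n, m)) (P : 'M[R]_(m, p)) :
  (\rank A <= \rank (A *m P)%R)%N -> exists E, A = A *m P *m E.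
Proof.
move=> rAP.
have sub : ((A *m P)^T <= A^T)%MS by rewrite trmx_mul submxMl.
have [_] := mxrank_leqif_eq sub; rewrite !mxrank_tr eqn_leq mxrankM_maxl rAP /=.
move=> /esym/andP[_ /submxP[D hD]]; exists D^T.
by rewrite -{1}(trmxK A) hD trmx_mul !trmxK.
Qed.

End Contraction.

(** * Density of the regular points *)

Section RegularDense.
Variable R : realType.

(* The fibre of [x |-> g x *m P] through [x0] is locally a Lipschitz graph, along
   which the constant rank of [g'] makes the derivative of [g] vanish. *)
Lemma constant_rank_fiber n m r (g : 'rV[R]_n -> 'rV[R]_m) g'
    (B : 'M[R]_(r, n)) (P : 'M[R]_(m, r)) x0 (d L : R) :
  (forall x, frechet g x (g' x)) -> 0 < d ->
  (forall z, `|z - x0| <= d -> l1 (B *m (g' z *m P) - 1%:M) <= 2^-1) ->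
  (forall z, `|z - x0| <= d -> l1 (g' z *m P) <= L) ->
  (forall z, `|z - x0| <= d -> (\rank (g' z) <= r)%N) ->
  exists2 eta : R, 0 < eta &
    forall x, `|x - x0| <= eta -> g x *m P = g x0 *m P -> g x = g x0.
Proof.
move=> gf d0 hB hL hr; pose f z := g z *m P.
have ff z : frechet f z (g' z *m P) by exact: frechet_mulmxr.
have L0 : 0 <= L.
  by apply: le_trans (l1_ge0 _) (hL x0 _); rewrite subrr normr0 ltW.
have Lf z z' : `|z - x0| <= d -> `|z' - x0| <= d -> `|f z - f z'| <= L * `|z - z'|.
  move=> hz hz'; apply: (frechet_lipschitz (D := fun t => g' (z' + t *: (z - z')) *m P)) => //.
  move=> t t01; split; [exact: ff | apply: hL; exact: norm_ball_convex].
have b0 : 0 < l1 B + 1 by rewrite ltr_wpDl ?l1_ge0.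
pose s := d / 2 / (l1 B + 1).
have s0 : 0 < s by rewrite !divr_gt0.
have hw x (w : 'rV_r) : `|x - x0| <= d / 2 -> `|w| <= s -> `|x + w *m B - x0| <= d.
  move=> hx ws; rewrite addrAC; apply: le_trans (ler_normD _ _) _.
  have : `|w *m B| <= d / 2.
    apply: le_trans (norm_mulmx_le _ _) _.
    apply: (@le_trans _ _ (s * (l1 B + 1))); last by rewrite divfK // gt_eqF.
    by apply: ler_pM => //; [exact: l1_ge0 | rewrite lerDl].
  lra.
(* The first bound keeps the segment in the half ball; the second moves [f] by at most [s / 2] along
   it, as [contraction_solve] demands. *)
pose eta := Num.min (d / 2) (s / 2 / (L + 1)).
have L1 : 0 < L + 1 by rewrite ltr_wpDl.
exists eta; first by rewrite lt_min !divr_gt0.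
move=> x hx fx; pose x_ (t : R) := x0 + t *: (x - x0).
have x_eta t : 0 <= t <= 1 -> `|x_ t - x0| <= eta.
  move=> t01; apply: norm_ball_convex => //.
  by rewrite subrr normr0 (le_trans _ hx).
have x_d t : 0 <= t <= 1 -> `|x_ t - x0| <= d / 2.
  by move=> /x_eta h; apply: le_trans h _; rewrite ge_min lexx.
(* [w t] is the correction that brings the segment point [x_ t] back onto the fibre of [f] through
   [x0]. *)
have /choice[w wP] (t : R) : exists w : 'rV_r, 0 <= t <= 1 ->
    `|w| <= s /\ f (x_ t + w *m B) = f x0.
  have [t01|] := boolP (0 <= t <= 1); last by exists 0.
  have [|w ws fw] := contraction_solve ff hB (ltW s0) (hw _ ^~ (x_d t t01)) (y := f x0).
    have h0 : `|x0 - x0| <= d by rewrite subrr normr0 ltW.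
    apply: le_trans (Lf _ _ _ h0) _.
      by apply: le_trans (x_d t t01) _; rewrite ler_pdivrMr // ler_peMr // ?ler1n // ltW.
    apply: (@le_trans _ _ ((L + 1) * (s / 2 / (L + 1)))).
      apply: ler_pM => //; first by rewrite lerDl.
      by apply: le_trans (x_eta t t01) _; rewrite ge_min lexx orbT.
    by rewrite mulrC divfK // gt_eqF.
  by exists w.
pose z_ t := x_ t + w t *m B.
have z_d t : 0 <= t <= 1 -> `|z_ t - x0| <= d.
  by move=> t01; apply: hw; [exact: x_d | have [] := wP t t01].
(* Corrections are unique, so a point already on the fibre is not moved; this applies at both ends
   of the segment. *)
have endpoint t : 0 <= t <= 1 -> f (x_ t) = f x0 -> z_ t = x_ t.
  move=> t01 ft; suff w0 : w t = 0 by rewrite /z_ w0 mul0mx addr0.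
  have h0 : `|x_ t + 0 *m B - x0| <= d.
    by apply: hw; [exact: x_d | rewrite normr0 ltW].
  have := contraction_expand ff hB (z_d t t01) h0.
  have [_ ->] := wP t t01.
  by rewrite mul0mx addr0 ft subrr normr0 mulr0 subr0 normr_le0 => /eqP.
have z_0 : z_ 0 = x0.
  have e : x_ 0 = x0 by rewrite /x_ scale0r addr0.
  by rewrite endpoint ?e // lexx ler01.
have z_1 : z_ 1 = x.
  have e : x_ 1 = x by rewrite /x_ scale1r addrC subrK.
  by rewrite endpoint ?e // lexx ler01.
pose K := `|x - x0| * (1 + 2 * L * l1 B) + 1.
have K0 : 0 < K by rewrite ltr_wpDl // mulr_ge0 // addr_ge0 // !mulr_ge0 // l1_ge0.
have z_lip t u : 0 <= t <= 1 -> 0 <= u <= 1 -> `|z_ u - z_ t| <= K * `|u - t|.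
  (* The intermediate point [y] shares its base point with [z_ t] and its correction with [z_ u]. As
     [f] agrees at [z_ t] and [z_ u], the change of correction is controlled by [f y - f (z_ u)],
     thus by [x_ u - x_ t]. *)
  move=> t01 u01; pose y := x_ t + w u *m B.
  have yd : `|y - x0| <= d by apply: hw; [exact: x_d | have [] := wP u u01].
  have hx_ : `|x_ u - x_ t| = `|u - t| * `|x - x0|.
    by rewrite /x_ opprD addrACA subrr add0r -scalerBl normrZ.
  have hwut : `|w u - w t| <= 2 * L * (`|u - t| * `|x - x0|).
    apply: le_trans (contraction_expand ff hB yd (z_d t t01)) _.
    have [_ ->] := wP t t01; have [_ <-] := wP u u01.
    rewrite -mulrA ler_wpM2l // distrC -hx_.
    apply: le_trans (Lf _ _ (z_d u u01) yd) _.
    by rewrite ler_wpM2l // /y opprD addrACA subrr addr0.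
  rewrite /z_ opprD addrACA -mulmxBl; apply: le_trans (ler_normD _ _) _.
  apply: le_trans (lerD (lexx _) (norm_mulmx_le _ _)) _; rewrite hx_.
  apply: (@le_trans _ _ (`|u - t| * `|x - x0| +
      2 * L * (`|u - t| * `|x - x0|) * l1 B)).
    by rewrite lerD2l ler_wpM2r // l1_ge0.
  have -> : K * `|u - t| = `|u - t| * `|x - x0| +
      2 * L * (`|u - t| * `|x - x0|) * l1 B + `|u - t| by rewrite /K; ring.
  by rewrite lerDl.
apply/eqP; rewrite -subr_eq0 -normr_le0 -z_0 -z_1.
apply: (mean_value_le (f := fun t => g (z_ t))) => // t t01 e e0.
have zd := z_d t t01.
(* [B *m (g' z *m P)] is close to the identity, so [g' z *m P] has rank at least [r], which bounds
   the rank of [g' z]. *)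
have [E gE] : exists E, g' (z_ t) = g' (z_ t) *m P *m E.
  apply: rank_mulmx_factor; apply: leq_trans (hr _ zd) _.
  have /eqP {1}<- := l1_half_row_free (hB _ zd); exact: mxrankM_maxr.
(* [Z] annihilates [g' (z_ t)] from the right but fixes the increment [D] of [g], since [D *m P = 0]
   on the fibre. So [D] is [Z] applied to the remainder of the linear approximation and is of
   smaller order than [u - t]: the mean value inequality applies with constant 0. *)
pose Z := 1%:M - P *m E.
have gZ : g' (z_ t) *m Z = 0 by rewrite mulmxBr mulmx1 mulmxA -gE subrr.
have c0 : 0 < l1 Z + 1 by rewrite ltr_wpDl ?l1_ge0.
have [d1 d10 hd1] := gf (z_ t) (e / (l1 Z + 1) / K) (divr_gt0 (divr_gt0 e0 c0) K0).
exists (d1 / K); first exact: divr_gt0.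
move=> u u01 ut; have zut := z_lip t u t01 u01.
have := hd1 (z_ u); set D := g _ - g _ => /(_ _) h.
have {}h := h (le_trans zut _).
rewrite mulrC -ler_pdivlMr // in h; have {}h := h ut.
have -> : D = (D - (z_ u - z_ t) *m g' (z_ t)) *m Z.
  rewrite [RHS]mulmxBl -mulmxA gZ mulmx0 subr0 /Z mulmxBr mulmx1 mulmxA.
  have -> : D *m P = 0.
    rewrite mulmxBl; have [_] := wP t t01; have [_] := wP u u01.
    by rewrite /f /z_ => -> ->; rewrite subrr.
  by rewrite mul0mx subr0.
rewrite add0r; apply: le_trans (norm_mulmx_le _ _) _.
apply: (@le_trans _ _ (e / (l1 Z + 1) / K * (K * `|u - t|) * (l1 Z + 1))).
  apply: ler_pM => //; [exact: l1_ge0 | | by rewrite lerDl].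
  by apply: le_trans h _; rewrite ler_wpM2l // !divr_ge0 // ltW.
by rewrite mulrA divfK ?gt_eqF // mulrAC divfK ?gt_eqF.
Qed.

Lemma open_map_regular_dense n m (g : 'rV[R]_n -> 'rV[R]_m) g' (W : set 'rV[R]_n) :
  (forall x, frechet g x (g' x)) -> continuous g' ->
  (forall U : set 'rV[R]_n, open U -> open (g @` U)) ->
  open W -> W !=set0 -> exists2 x, W x & row_full (g' x).
Proof.
move=> gf g'c gO oW [a Wa].
pose Q (k : nat) := `[< exists2 x, W x & \rank (g' x) = k >].
have Qex : exists k, Q k by exists (\rank (g' a)); apply/asboolP; exists a.
have Qub k : Q k -> (k <= m)%N by move=> /asboolP[x _ <-]; exact: rank_leq_col.
case: (ex_maxnP Qex Qub) => r /asboolP[x0 Wx0 rx0] rmax.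
have [rm|rm] := eqVneq r m; first by exists x0 => //; rewrite /row_full rx0 rm.
exfalso.
have {rm}rm : (r < m)%N by rewrite ltn_neqAle rm Qub //; apply/asboolP; exists x0.
have [B [P BP]] := rank_factor (g' x0); rewrite rx0 in B P BP.
have bp0 : 0 < l1 B * l1 P + 1 by rewrite ltr_wpDl // mulr_ge0 // l1_ge0.
have [d1 d10 hd1] := open_norm_ball oW Wx0.
pose e0 := 2^-1 / (l1 B * l1 P + 1).
have e00 : 0 < e0 by rewrite divr_gt0 // invr_gt0.
have [d2 d20 hd2] := continuous_l1 (g'c x0) e00.
pose d := Num.min d1 d2.
have d0 : 0 < d by rewrite lt_min d10.
have hB z : `|z - x0| <= d -> l1 (B *m (g' z *m P) - 1%:M) <= 2^-1.
  rewrite le_min => /andP[_ /hd2 h].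
  rewrite -BP -mulmxA -mulmxBr -mulmxBl.
  apply: le_trans (l1_mul _ _) _.
  apply: (@le_trans _ _ (l1 B * (e0 * l1 P))).
    apply: ler_wpM2l; first exact: l1_ge0.
    by apply: le_trans (l1_mul _ _) _; rewrite ler_wpM2r // l1_ge0.
  have -> : l1 B * (e0 * l1 P) = e0 * (l1 B * l1 P) by ring.
  rewrite -[leRHS](divfK (lt0r_neq0 bp0)) -/e0; apply: ler_wpM2l; first exact: ltW.
  by rewrite lerDl.
have hL z : `|z - x0| <= d -> l1 (g' z *m P) <= (e0 + l1 (g' x0)) * l1 P.
  rewrite le_min => /andP[_ /hd2 h].
  apply: le_trans (l1_mul _ _) _; rewrite ler_wpM2r ?l1_ge0 //.
  rewrite -[g' z](subrK (g' x0)); apply: le_trans (l1D _ _) _.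
  by rewrite lerD2r.
have hr z : `|z - x0| <= d -> (\rank (g' z) <= r)%N.
  rewrite le_min => /andP[/hd1 h _].
  by apply: rmax; apply/asboolP; exists z.
have [eta eta0 fib] := constant_rank_fiber gf d0 hB hL hr.
(* [P] has more rows than columns, hence kills some [k]. Openness puts a small shift of [g x0] along
   [k] into the image of the ball, although the projection by [P] does not see this shift. *)
have [k kP k0] : exists2 k : 'rV[R]_m, k *m P = 0 & k != 0.
  have : kermx P != 0.
    rewrite kermx_eq0 /row_free neq_ltn (leq_ltn_trans (rank_leq_col _) rm) //.
  move=> /rowV0Pn[k /sub_kermxP kP k0]; by exists k.
have gx0 : (g @` ball x0 eta) (g x0) by exists x0 => //; exact: ballxx.
have [d3 d30 hd3] := open_norm_ball (gO _ (ball_open x0 eta)) gx0.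
have [x xeta gx] : (g @` ball x0 eta) (g x0 + (d3 / `|k|) *: k).
  apply: hd3; rewrite addrC addKr normrZ ger0_norm; last first.
    by rewrite divr_ge0 // ltW.
  by rewrite divfK // normr_eq0.
have : g x = g x0.
  apply: fib; first by move: xeta; rewrite -ball_normE /ball_ /= distrC => /ltW.
  by rewrite gx mulmxDl -scalemxAl kP scaler0 addr0.
rewrite gx => /eqP; rewrite -subr_eq0 addrC addKr scaler_eq0 (negPf k0) orbF.
by rewrite mulf_eq0 invr_eq0 normr_eq0 (negPf k0) orbF gt_eqF.
Qed.

End RegularDense.

(** * Certified image balls *)

Definition code_mx (k l t : nat) : 'M[Rl]_(k, l) :=
  \matrix_(i, j) code_val (i * l + j) t.

Definition computable_mx k l (A : nat -> 'M[Rl]_(k, l)) : Prop :=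
  forall i j, computable_rat (fun e => A e i j).

Lemma computable_code_mx k l f :
  computable_nat f -> computable_mx (fun e => code_mx k l (f e)).
Proof.
move=> hf i j; apply: eq_computable_rat (computable_rat_code_val
  (computable_nat_const (i * l + j)) hf) => e.
by rewrite mxE.
Qed.

Lemma computable_mx_mul k l r (A : nat -> 'M[Rl]_(k, l)) (B : nat -> 'M[Rl]_(l, r)) :
  computable_mx A -> computable_mx B -> computable_mx (fun e => A e *m B e).
Proof.
move=> hA hB i j; apply: eq_computable_rat (computable_rat_sum
  (fun s => computable_rat_mul (hA i s) (hB s j))) => e.
by rewrite mxE.
Qed.

Lemma computable_mx_sub1 k (A : nat -> 'M[Rl]_k) :
  computable_mx A -> computable_mx (fun e => A e - 1%:M).
Proof.
move=> hA i j; apply: eq_computable_rat (computable_rat_add (hA i j)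
  (computable_rat_opp (computable_rat_nat (computable_nat_const (i == j))))) => e.
by rewrite !mxE.
Qed.

Lemma computable_rat_l1 k l (A : nat -> 'M[Rl]_(k, l)) :
  computable_mx A -> computable_rat (fun e => l1 (A e)).
Proof.
move=> hA; apply: computable_rat_sum => i; apply: computable_rat_sum => j.
exact: computable_rat_norm.
Qed.

Lemma mx_name_code k l (A : 'M[Rl]_(k, l)) p N :
  mx_name A p -> `|A - code_mx k l (p N)| <= (2 ^+ N)^-1.
Proof.
move=> /(_ N)[qs [qsz [-> h]]]; apply: mx_norm_le => [|i j].
  by rewrite invr_ge0 exprn_ge0.
rewrite !mxE code_val_enc //.
by rewrite qsz (leq_trans (n := i * l + l)) ?ltn_add2l // -mulSnr leq_mul2r ltn_ord orbT.
Qed.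

Lemma code_mx_enc_qvec d qs :
  size qs = d -> code_mx 1 d (enc_qvec qs) = qvec d qs.
Proof. by move=> <-; apply/rowP => i; rewrite !mxE /= mul0n add0n code_val_enc. Qed.

Lemma vec_name_code d (x : 'rV[Rl]_d) p N :
  vec_name x p -> `|x - code_mx 1 d (p N)| <= (2 ^+ N)^-1.
Proof.
move=> /(_ N)[qs [qsz [-> h]]]; apply: mx_norm_le => [|i j].
  by rewrite invr_ge0 exprn_ge0.
by rewrite code_mx_enc_qvec // !mxE ord1.
Qed.

Lemma code_mx_dense k l (A : 'M[Rl]_(k, l)) (e : Rl) :
  0 < e -> exists t, `|A - code_mx k l t| <= e.
Proof.
move=> e0.
(* Entries are chosen over pairs of naturals, with default [q0] out of range, so that a flat list
   can be filled by quotient and remainder. *)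
have /choice[q qP] (ij : nat * nat) : exists q, forall (i : 'I_k) (j : 'I_l),
    ij = (nat_of_ord i, nat_of_ord j) -> `|A i j - rat_val q| <= e.
  have [[[i j] /= ->]|h] := pselect (exists i : 'I_k * 'I_l, ij = (i.1 : nat, i.2 : nat)).
      have [q qP] := rat_val_dense (A i j) e0; exists q => i' j' [].
    by move=> /val_inj <- /val_inj <-.
  by exists q0 => i j ijE; exfalso; apply: h; exists (i, j).
exists (enc_qvec (mkseq (fun s => q (s %/ l, s %% l)%N) (k * l))).
apply: mx_norm_le => [|i j]; first exact: ltW.
have il : (i * l + j < k * l)%N.
  by rewrite (leq_trans (n := i * l + l)) ?ltn_add2l // -mulSnr leq_mul2r ltn_ord orbT.
have l0 : (0 < l)%N by apply: leq_ltn_trans (ltn_ord j).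
rewrite !mxE code_val_enc ?size_mkseq // nth_mkseq //.
apply: qP; rewrite divnMDl // modnMDl divn_small // addn0 modn_small //.
Qed.

(** Stated for all large exponents, so that several demands are met by a maximum. *)
Lemma exp2V_small (e : Rl) : 0 < e ->
  exists k, forall K, (k <= K)%N -> (2 ^+ K)^-1 <= e.
Proof.
move=> e0; exists (Num.truncn e^-1).+1 => K kK.
rewrite invf_ple ?posrE ?exprn_gt0 //.
apply: (@le_trans _ _ K%:R); last by rewrite -natrX ler_nat ltnW // ltn_expl.
by apply: le_trans (ltW (truncnS_gt _)) _; rewrite ler_nat.
Qed.

Lemma eball_norm d (y z : 'rV[Rl]_d) (r : Rl) : 0 <= r -> eball y r z -> `|y - z| <= r.
Proof.
move=> r0 h; apply: mx_norm_le => // i j; rewrite ord1 !mxE distrC.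
rewrite -(ler_pXn2r (n := 2)) ?nnegrE // real_normK ?num_real //.
apply: le_trans (ltW h); rewrite (bigD1 j) //= lerDl.
by apply: sumr_ge0 => s _; exact: sqr_ge0.
Qed.

(** The sum is the squared Euclidean distance from [q] to the farthest corner of the box of radius
    [e] around [c], which turns inclusion of a box in a named ball into a decidable test on
    rationals. *)
Lemma norm_ball_sub_eball d (c q z : 'rV[Rl]_d) (e r : Rl) :
  \sum_i (`|c ord0 i - q ord0 i| + e) ^+ 2 < r ^+ 2 -> `|z - c| <= e -> eball q r z.
Proof.
move=> h zc; apply: le_lt_trans h; apply: ler_sum => i _.
rewrite -[leLHS]real_normK ?num_real //.
have zi : `|z ord0 i - c ord0 i| <= e.
  by have := mx_entry_le (z - c) ord0 i; rewrite !mxE => h; exact: le_trans h zc.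
have e0 : 0 <= e := le_trans (normr_ge0 _) zi.
rewrite ler_pXn2r ?nnegrE ?addr_ge0 //.
have -> : z ord0 i - q ord0 i = (c ord0 i - q ord0 i) + (z ord0 i - c ord0 i) by ring.
by apply: le_trans (ler_normD _ _) _; rewrite lerD2l.
Qed.

(** Completeness of the corner test: for [e <= 1], [(a + e) ^+ 2] exceeds [a ^+ 2] by at most
    [e * (2 * a + 1)], and [T] sums these slopes. *)
Lemma eball_enlarge d (c q : 'rV[Rl]_d) (r : Rl) : eball q r c ->
  exists k, forall K, (k <= K)%N ->
    \sum_i (`|c ord0 i - q ord0 i| + (2 ^+ K)^-1) ^+ 2 < r ^+ 2.
Proof.
rewrite /eball /= -subr_gt0; set S := \sum_i _; set D := _ - S => D0.
pose T : Rl := \sum_(i < d) (2 * `|c ord0 i - q ord0 i| + 1).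
have T0 : 0 <= T by apply: sumr_ge0 => i _; rewrite addr_ge0 // mulr_ge0.
have T1 : 0 < T + 1 by rewrite ltr_wpDl.
have [k hk] := exp2V_small (divr_gt0 D0 T1).
exists k => K /hk; set e := (2 ^+ K)^-1 => he.
have e0 : 0 < e by rewrite invr_gt0 exprn_gt0.
have e1 : e <= 1 by rewrite invf_le1 ?exprn_gt0 // exprn_ege1 // ler1n.
have : \sum_i (`|c ord0 i - q ord0 i| + e) ^+ 2 <= S + e * T.
  rewrite /S /T mulr_sumr -big_split; apply: ler_sum => i _ /=.
  rewrite -[(c ord0 i - _) ^+ 2]real_normK ?num_real //.
  have := normr_ge0 (c ord0 i - q ord0 i); move: `|_| => a a0; nra.
move=> /le_lt_trans; apply; rewrite addrC -ltrBrDr -/D.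
by move: he; rewrite ler_pdivlMr //; lra.
Qed.

(** The target [y'] is within [2 * r] of [g c]: [r] for the inexact centre and [r] for the radius.
    Solving costs another factor 2, hence corrections of size [4 * r]. *)
Lemma image_contains_eball n m (g : 'rV[Rl]_n -> 'rV[Rl]_m) g' (c : 'rV[Rl]_n)
    (B : 'M[Rl]_(m, n)) M (d e r : Rl) y y' :
  (forall x, frechet g x (g' x)) ->
  (forall z, `|z - c| <= d -> l1 (g' z - M) <= e) ->
  l1 (B *m M - 1%:M) + l1 B * e <= 2^-1 ->
  l1 B * (4 * r) <= d -> 0 <= r -> `|g c - y| <= r -> eball y r y' ->
  exists2 z, `|z - c| <= d & g z = y'.
Proof.
move=> gf hM hB hd r0 gy /(eball_norm r0) yy'.
have hg z : `|z - c| <= d -> l1 (B *m g' z - 1%:M) <= 2^-1.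
  move=> /hM h; apply: le_trans hB.
  have -> : B *m g' z - 1%:M = (B *m M - 1%:M) + B *m (g' z - M).
    by rewrite mulmxBr [RHS]addrC addrA subrK.
  apply: le_trans (l1D _ _) _; rewrite lerD2l.
  by apply: le_trans (l1_mul _ _) _; rewrite ler_wpM2l // l1_ge0.
have hw (w : 'rV_m) : `|w| <= 4 * r -> `|c + w *m B - c| <= d.
  move=> wr; rewrite addrC addKr; apply: le_trans (norm_mulmx_le _ _) _.
  by apply: le_trans hd; rewrite mulrC ler_wpM2l // l1_ge0.
have [||w ws <-] := contraction_solve gf hg _ hw (y := y').
- by rewrite mulr_ge0.
- by rewrite -[g c - y'](subrKA y) (le_trans (ler_normD _ _)) //; lra.
by exists (c + w *m B) => //; exact: hw.
Qed.

(** The bound is a quarter, so that another quarter remains for the inexact values of [g'] in the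
    certificate. Each eighth pays for one rounding: the regular point, then the inverse of its
    derivative. *)
Lemma rational_regular_point n m (g : 'rV[Rl]_n -> 'rV[Rl]_m) g' (W : set 'rV[Rl]_n) :
  (forall x, frechet g x (g' x)) -> continuous g' ->
  (forall U : set 'rV[Rl]_n, open U -> open (g @` U)) ->
  open W -> W !=set0 ->
  exists t s, W (code_mx 1 n t) /\
    l1 (code_mx m n s *m g' (code_mx 1 n t) - 1%:M) <= 4^-1.
Proof.
move=> gf g'c gO oW W0.
have [x Wx xfull] := open_map_regular_dense gf g'c gO oW W0.
pose A := pinvmx (g' x); have AE : A *m g' x = 1%:M by exact: mulVpmx.
have [d1 d10 hd1] := open_norm_ball oW Wx.
have a0 : 0 < l1 A + 1 by rewrite ltr_wpDl ?l1_ge0.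
have e0 : 0 < 8^-1 / (l1 A + 1) :> Rl by rewrite divr_gt0.
have [d2 d20 hd2] := continuous_l1 (g'c x) e0.
have d0 : 0 < Num.min d1 d2 by rewrite lt_min d10.
have [t] := code_mx_dense x d0; rewrite distrC le_min => /andP[/hd1 Wt /hd2 ht].
set c := code_mx 1 n t in Wt ht *.
have f0 : 0 < (m * n)%:R * l1 (g' c) + 1 by rewrite ltr_wpDl ?mulr_ge0 ?l1_ge0.
have e'0 : 0 < 8^-1 / ((m * n)%:R * l1 (g' c) + 1) :> Rl by rewrite divr_gt0.
(* The inverse is rounded only after the point, as the tolerance depends on [g' c]. *)
have [s hs] := code_mx_dense A e'0.
exists t, s; split => //; rewrite -/c.
have -> : code_mx m n s *m g' c - 1%:M =
    A *m (g' c - g' x) + (code_mx m n s - A) *m g' c.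
  by rewrite mulmxBr mulmxBl AE [RHS]addrC addrA subrK.
apply: le_trans (l1D _ _) _.
have -> : 4^-1 = 8^-1 + 8^-1 :> Rl by lra.
apply: lerD; apply: le_trans (l1_mul _ _) _.
  apply: (@le_trans _ _ ((l1 A + 1) * (8^-1 / (l1 A + 1)))).
    by apply: ler_pM => //; [exact: l1_ge0 | exact: l1_ge0 | rewrite lerDl].
  by rewrite mulrC divfK // gt_eqF.
apply: (@le_trans _ _ ((m * n)%:R * `|A - code_mx m n s| * l1 (g' c))).
  by rewrite ler_wpM2r ?l1_ge0 // distrC l1_le_norm.
rewrite mulrAC mulrC.
apply: (@le_trans _ _ (8^-1 / ((m * n)%:R * l1 (g' c) + 1) *
   ((m * n)%:R * l1 (g' c) + 1))); last by rewrite divfK // gt_eqF.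
by apply: ler_pM => //; [rewrite mulr_ge0 ?l1_ge0 | rewrite lerDl].
Qed.

Lemma computable_rat_sqr F : computable_rat F -> computable_rat (fun e => F e ^+ 2).
Proof. by move=> hF; exact: (computable_rat_mul hF hF). Qed.

(* Input [npair t b], where [b] is an entry of the given name of [U] and [t] lists:
   the index of [b]; codes of a rational point [c], of a precision [N] for [g' c], of
   a radius [2 ^- K] and of an approximate right inverse [B] of [g' c]; and a
   precision [k] for [g c], which is also the exponent of the radius of the image
   ball.  [l] and [v] evaluate [g'] at [c] as in [computable_eval]. *)
Definition cert (j e : nat) : nat := code_nth j (ufst e).

Definition input_center (e : nat) : nat := ufst (usnd e).-1.

Definition input_radius (e : nat) : Rl :=
  (ufst (usnd (usnd e).-1))%:R / (usnd (usnd (usnd e).-1)).+1%:R.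

Lemma ball_code_inj qs (u a b a' b' : nat) :
  (npair u (npair a b)).+1 = ball_code qs a' b' -> [/\ u = enc_qvec qs, a = a' & b = b'].
Proof.
move=> /eqP; rewrite /ball_code eqSS => /eqP h.
have := congr1 usnd h; have := congr1 ufst h; rewrite !(usnd_npair, ufst_npair).
move=> -> h2; split => //; first by have := congr1 ufst h2; rewrite !ufst_npair.
by have := congr1 usnd h2; rewrite !usnd_npair.
Qed.

Lemma input_center_ball_code t qs a b :
  input_center (npair t (ball_code qs a b)) = enc_qvec qs.
Proof. by rewrite /input_center usnd_npair /ball_code succnK ufst_npair. Qed.

Lemma input_radius_ball_code t qs a b :
  input_radius (npair t (ball_code qs a b)) = a%:R / b.+1%:R.
Proof.
by rewrite /input_radius usnd_npair /ball_code succnK !(usnd_npair, ufst_npair).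
Qed.

(** The tests say that the entry is a ball; that it contains the box of radius [2 ^- K] around [c];
    that the computed matrix approximates [g'] on all of this box; and that the two numerical
    hypotheses of [image_contains_eball] hold with [d = 2 ^- K], [r = 2 ^- k] and error
    [n * m * 2 ^- N]. *)
Definition certified (n m : nat) (l v : nat -> nat) (e : nat) : bool :=
  let u := npair (cert 1 e) (cert 2 e) in
  let B := code_mx m n (cert 4 e) in
  [&& usnd e != 0%N,
    \sum_(i < n) (`|code_mx 1 n (cert 1 e) ord0 i - code_mx 1 n (input_center e) ord0 i|
       + (2 ^+ cert 3 e)^-1) ^+ 2 < input_radius e ^+ 2,
    (l u <= cert 3 e)%N,
    l1 (B *m code_mx n m (v u) - 1%:M) + l1 B * ((n * m)%:R * (2 ^+ cert 2 e)^-1)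
      <= 2^-1 &
    l1 B * (4 * (2 ^+ cert 5 e)^-1) <= (2 ^+ cert 3 e)^-1].

Definition image_ball (n m : nat) (l v v' : nat -> nat) (e : nat) : nat :=
  if certified n m l v e then
    (npair (v' (npair (cert 1 e) (cert 5 e))) (npair 1 (2 ^ cert 5 e).-1)).+1
  else 0%N.

Lemma computable_nat_cert j : computable_nat (cert j).
Proof.
apply: computable_nat_code_nth; first exact: computable_nat_const.
exact: computable_nat_ufst computable_nat_id.
Qed.

Lemma computable_certified n m l v : computable_nat l -> computable_nat v ->
  computable_pred (certified n m l v).
Proof.
move=> hl hv; have hc := computable_nat_cert.
have hb : computable_nat (fun e => (usnd e).-1).
  apply: computable_nat_comp computable_nat_pred _.
  exact: computable_nat_usnd computable_nat_id.
have hu := computable_nat_npair (hc 1%N) (hc 2%N).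
have hB := @computable_code_mx m n _ (hc 4%N).
have hM := @computable_code_mx n m _ (computable_nat_comp hv hu).
apply: computable_predI.
  apply: computable_predN; apply: computable_pred_eq0.
  exact: computable_nat_usnd computable_nat_id.
apply: computable_predI.
  apply: computable_pred_ltr; last first.
    apply: computable_rat_sqr; apply: computable_rat_frac.
      exact: computable_nat_ufst (computable_nat_usnd hb).
    exact: computable_nat_usnd (computable_nat_usnd hb).
  apply: computable_rat_sum => i; apply: computable_rat_sqr.
  apply: computable_rat_add (computable_rat_exp2V (hc 3%N)).
  apply: computable_rat_norm; apply: computable_rat_add.
    exact: (@computable_code_mx 1 n _ (hc 1%N)).
  apply: computable_rat_opp; exact: (@computable_code_mx 1 n _ (computable_nat_ufst hb)).
apply: computable_predI; first exact: computable_pred_leq (computable_nat_comp hl hu) _.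
have hBl := computable_rat_l1 hB.
apply: computable_predI; apply: computable_pred_ler.
- apply: computable_rat_add.
    exact: computable_rat_l1 (computable_mx_sub1 (computable_mx_mul hB hM)).
  apply: computable_rat_mul hBl _; apply: computable_rat_mul.
    exact: computable_rat_nat (computable_nat_const _).
  exact: computable_rat_exp2V.
- apply: eq_computable_rat (computable_rat_frac (computable_nat_const 1)
    (computable_nat_const 1)) => e; by rewrite mul1r.
- apply: computable_rat_mul hBl _; apply: computable_rat_mul.
    exact: computable_rat_nat (computable_nat_const 4).
  exact: computable_rat_exp2V.
- exact: computable_rat_exp2V.
Qed.

Lemma computable_image_ball n m l v v' :
  computable_nat l -> computable_nat v -> computable_nat v' ->
  computable_nat (image_ball n m l v v').
Proof.
move=> hl hv hv'; have hc := computable_nat_cert.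
apply: computable_nat_if; first exact: computable_certified.
  apply: computable_nat_succ; apply: computable_nat_npair.
    by apply: computable_nat_comp hv' _; exact: computable_nat_npair.
  apply: computable_nat_npair; first exact: computable_nat_const.
  apply: computable_nat_comp computable_nat_pred _; exact: computable_nat_exp2.
exact: computable_nat_const.
Qed.

(** * Topology of the image and of named sets, and the conclusion *)

Lemma closure_image_bounded n m (g : 'rV[Rl]_n -> 'rV[Rl]_m) (A : set 'rV[Rl]_n)
    (U : set 'rV[Rl]_n) (V : set 'rV[Rl]_m) :
  continuous g -> bounded_vset A -> closure U = A -> V `<=` g @` U ->
  (forall x O, U x -> open O -> O (g x) -> V `&` O !=set0) ->
  closure V = g @` A.
Proof.
move=> gc [M AM] UA VU VO; have clA : closed A by rewrite -UA; exact: closed_closure.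
have Acompact : compact A.
  apply: bounded_closed_compact => //; exists M; split; first exact: num_real.
  by move=> r Mr x Ax; exact: le_trans (AM x Ax) (ltW Mr).
have gA : closed (g @` A).
  apply: compact_closed; first exact: norm_hausdorff.
  apply: continuous_compact => //; exact: continuous_subspaceT.
apply/seteqP; split.
  rewrite closureE; apply: smallest_sub => // y /VU[x Ux <-]; exists x => //.
  by rewrite -UA; exact: subset_closure.
move=> _ [x Ax <-] O Ox; move: Ax; rewrite -UA.
have gxO : nbhs x (g @^-1` O^°) by apply: gc; exact: nbhs_interior.
move=> /(_ _ gxO)[z [Uz gzO]].
have [y [Vy Oy]] := VO z _ Uz (open_interior O) gzO.
by exists y; split => //; exact: interior_subset.
Qed.

Lemma eball_open d (c : 'rV[Rl]_d) r : open (eball c r).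
Proof.
rewrite openE => z /eball_enlarge[k hk].
suff : \forall y \near z, eball c r y by [].
apply/nbhs_normP; exists (2 ^+ k)^-1; first by rewrite /= invr_gt0 exprn_gt0.
move=> y; rewrite /ball_ /= distrC => /ltW.
exact: norm_ball_sub_eball (hk k (leqnn k)).
Qed.

Lemma open_name_open d (U : set 'rV[Rl]_d) p : open_name U p -> open U.
Proof.
move=> [_ UE]; rewrite (_ : U = \bigcup_(B in [set B | B `<=` U /\ open B]) B).
  by apply: bigcup_open => B [].
apply/seteqP; split => [z|z [B [BU _]]]; last exact: BU.
rewrite {1}UE => -[k [qs [a [b [qsz [pk hz]]]]]].
exists (eball (qvec d qs) (a%:R / b.+1%:R)) => //; split; last exact: eball_open.
by move=> w hw; rewrite UE; exists k, qs, a, b.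
Qed.

Unset Implicit Arguments.
Set Strict Implicit.
Set Printing Implicit Defensive.

Theorem theorem7 (n m : nat) (g : 'rV[Rl]_n -> 'rV[Rl]_m)
    (g' : 'rV[Rl]_n -> 'M[Rl]_(n, m)) :
  computable_vecfun g ->
  (forall U : set 'rV[Rl]_n, open U -> open (g @` U)) ->
  (forall x, differentiable g x /\ forall v, 'd g x v = v *m g' x) ->
  continuous g' ->
  computable_vec2mx g' ->
  computable_rc_map (fun A : set 'rV[Rl]_n => g @` A).
Proof.
move=> [ag [agc agP]] gO gd g'c [ag' [ag'c ag'P]].
have gf x : frechet g x (g' x).
  by have [gx dgx] := gd x; exact: differentiable_frechet.
have gc : continuous g by move=> x; exact: frechet_continuous (gf x).
have hfst := computable_nat_ufst computable_nat_id.
have hsnd := computable_nat_usnd computable_nat_id.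
have [l [v [lc vc lvP]]] := computable_eval ag'c ag'P hfst hsnd.
have [l' [v' [_ v'c v'P]]] := computable_eval agc agP hfst hsnd.
have [alpha alphac alphaP] := runs_pointwise
  (computable_nat_code_nth (computable_nat_const 0) computable_nat_id)
  (computable_image_ball n m lc vc v'c).
have g'_approx C N K z : (l (npair C N) <= K)%N ->
    `|z - code_mx 1 n C| <= (2 ^+ K)^-1 ->
    `|g' z - code_mx n m (v (npair C N))| <= (2 ^+ N)^-1.
  move=> lK hz; have [i|q [qz]] := lvP (npair C N) z.
    have := mx_entry_le (z - code_mx 1 n C) ord0 i.
    rewrite !mxE /= mul0n add0n ufst_npair => h; apply: le_trans h _.
    apply: le_trans hz _; rewrite lef_pV2 ?posrE ?exprn_gt0 //.
    by rewrite ler_weXn2l // ler1n.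
  by rewrite usnd_npair => <-; exact: mx_name_code.
have g_approx C k : `|g (code_mx 1 n C) - code_mx 1 m (v' (npair C k))| <= (2 ^+ k)^-1 /\
    exists2 qs, size qs = m & v' (npair C k) = enc_qvec qs.
  have [i|q [qz]] := v'P (npair C k) (code_mx 1 n C).
    rewrite !mxE /= mul0n add0n ufst_npair subrr normr0 invr_ge0 exprn_ge0 //.
  rewrite usnd_npair => <-; split; first exact: vec_name_code.
  by have [qs [qsz [-> _]]] := qz k; exists qs.
exists alpha; split => // A p bA _ [U [[pU UE] UA]].
exists (fun t => image_ball n m l v v' (npair t (p (code_nth 0 t)))).
split; first exact: alphaP.
(* The named set is left open and becomes, by unification, the union of the listed balls. *)
eexists; split; first (split; last by []).
  move=> t; rewrite /image_ball; case: ifP => _; last by left.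
  right; have [_ [qs qsz ->]] := g_approx (cert 1 (npair t (p (code_nth 0 t))))
    (cert 5 (npair t (p (code_nth 0 t)))).
  by exists qs, 1%N, (2 ^ cert 5 (npair t (p (code_nth 0 t)))).-1.
have pow2 (k : nat) : 1%:R / (2 ^ k).-1.+1%:R = (2 ^+ k)^-1 :> Rl.
  by rewrite prednK ?expn_gt0 // mul1r natrX.
apply: (closure_image_bounded gc bA UA) => [y|x O Ux oO Ogx].
  move=> [t [qs [a [b [qsz []]]]]]; set e := npair _ _.
  rewrite /image_ball; case: ifP => // /and5P[bn0 sub lK B1 B2].
  move=> /ball_code_inj[hqs <- <-].
  rewrite pow2 -(code_mx_enc_qvec qsz) -hqs => hy.
  have rho0 k : 0 <= (2 ^+ k)^-1 :> Rl by rewrite invr_ge0 exprn_ge0.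
  have hM z : `|z - code_mx 1 n (cert 1 e)| <= (2 ^+ cert 3 e)^-1 ->
      l1 (g' z - code_mx n m (v (npair (cert 1 e) (cert 2 e)))) <=
      (n * m)%:R * (2 ^+ cert 2 e)^-1.
    move=> hz; apply: le_trans (l1_le_norm _) _.
    by rewrite ler_wpM2l //; exact: g'_approx lK hz.
  have [hgc _] := g_approx (cert 1 e) (cert 5 e).
  have [z zc gz] := image_contains_eball gf hM B1 B2 (rho0 _) hgc hy.
  exists z => //; rewrite UE; have [p0|[qs' [a' [b' [qs'z pE]]]]] := pU (code_nth 0 t).
    by move: bn0; rewrite /e usnd_npair p0.
  exists (code_nth 0 t), qs', a', b'; do 2!split => //.
  have := norm_ball_sub_eball sub zc; rewrite /e pE.
  by rewrite input_center_ball_code input_radius_ball_code code_mx_enc_qvec.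
have oU : open U by exact: open_name_open (conj pU UE).
(* Density: a rational regular point of [U] that [g] sends into [O] will yield a certificate whose
   image ball has its centre in [O]. *)
have [||C [s [[UC OC] hs]]] := @rational_regular_point _ _ g g' (U `&` g @^-1` O) gf g'c gO.
- by apply: openI => //; apply: open_comp => // z _; exact: gc.
- by exists x.
set c := code_mx 1 n C in UC OC hs; set B := code_mx m n s in hs.
have [d d0 hd] := open_norm_ball oO OC.
move: UC; rewrite UE => -[i [qs [a [b [qsz [pi hc]]]]]].
have [K1 hK1] := eball_enlarge hc.
have b0 : 0 < 2 * l1 B * (n * m)%:R + 1 by rewrite ltr_wpDl // !mulr_ge0 // l1_ge0.
(* The precisions are chosen in the order [N], [K], [k]. [N] makes twice the matrix error term at
   most a quarter: once for replacing [g' c] by its computed value, once for the test's own margin.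
   [K] fits the box into the ball and below the reading depth for [N]; [k] makes the image ball
   small relative to that box and puts its centre in [O]. *)
have [N hN] := exp2V_small (divr_gt0 (ltr0Sn Rl 0) (mulr_gt0 (ltr0Sn Rl 3) b0)).
have {}hN := hN N (leqnn N).
pose K := maxn K1 (l (npair C N)).
have [k1 hk1] := exp2V_small d0.
have eK : 0 < (2 ^+ K)^-1 :> Rl by rewrite invr_gt0 exprn_gt0.
have b1 : 0 < l1 B * 4 + 1 by rewrite ltr_wpDl // mulr_ge0 // l1_ge0.
have [k2 hk2] := exp2V_small (divr_gt0 eK b1).
pose k := maxn k1 k2.
have {}hk1 := hk1 k (leq_maxl _ _); have {}hk2 := hk2 k (leq_maxr _ _).
pose t := enc_list [:: i; C; N; K; s; k].
have certE : [/\ cert 1 (npair t (p i)) = C, cert 2 (npair t (p i)) = N,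
    cert 3 (npair t (p i)) = K, cert 4 (npair t (p i)) = s &
    cert 5 (npair t (p i)) = k].
  by rewrite /cert ufst_npair /t !code_nth_enc.
case: certE => c1 c2 c3 c4 c5.
have ti : code_nth 0 t = i by rewrite /t code_nth_enc.
have [hgc [ys ysz vE]] := g_approx C k.
have cert_ok : certified n m l v (npair t (p i)).
  have lK : (l (npair C N) <= K)%N by rewrite leq_maxr.
  rewrite /certified c1 c2 c3 c4 c5 pi input_center_ball_code input_radius_ball_code.
  rewrite usnd_npair code_mx_enc_qvec //; apply/and5P; split => //.
  - by apply: hK1; exact: leq_maxl.
  - set M := code_mx n m _.
    have gM : l1 (g' c - M) <= (n * m)%:R * (2 ^+ N)^-1.
      apply: le_trans (l1_le_norm _) _; rewrite ler_wpM2l //.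
      by apply: (g'_approx _ _ K) => //; rewrite subrr normr0 ltW.
    have -> : B *m M - 1%:M = (B *m g' c - 1%:M) + (- B) *m (g' c - M).
      rewrite mulNmx mulmxBr opprB [RHS]addrC addrA subrK //.
    have hl : l1 (- B *m (g' c - M)) <= l1 B * ((n * m)%:R * (2 ^+ N)^-1).
      apply: le_trans (l1_mul _ _) _.
      have -> : l1 (- B) = l1 B.
        by apply: eq_bigr => ? _; apply: eq_bigr => ? _; rewrite mxE normrN.
      by rewrite ler_wpM2l // l1_ge0.
    have h2 : 2 * (l1 B * ((n * m)%:R * (2 ^+ N)^-1)) <= 4^-1.
      move: hN; rewrite ler_pdivlMr ?mulr_gt0 //.
      have : 0 < (2 ^+ N)^-1 :> Rl by rewrite invr_gt0 exprn_gt0.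
      by move: (2 ^+ N)^-1 => r r0; lra.
    apply: le_trans (lerD (l1D _ _) (lexx _)) _; lra.
  - move: hk2; rewrite ler_pdivlMr //.
    have : 0 <= (2 ^+ k)^-1 :> Rl by rewrite invr_ge0 exprn_ge0.
    by move: (2 ^+ k)^-1 => r r0; lra.
exists (qvec m ys); split; last first.
  by apply: hd; rewrite -code_mx_enc_qvec // -vE distrC; exact: le_trans hgc hk1.
exists t, ys, 1%N, (2 ^ k).-1; split => //; split.
  by rewrite ti /image_ball cert_ok c1 c5 vE.
rewrite pow2 /eball /= big1 ?exprn_gt0 ?invr_gt0 ?exprn_gt0 // => j _.
by rewrite subrr expr0n.
Qed.
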